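(* Let $K/F$ be a finite Galois extension of number fields and let $S$ be a finite set of primes of $F$ containing the set $S_\infty$ of all archimedean primes of $F$. If $K/F$ is unramified outside $S$, then $$\operatorname{Ker}(\epsilon_{K/F,S}) \simeq H^1(\operatorname{Gal}(K/F),U_{K,S}) \quad\text{and}\quad \operatorname{Ost}(K/F)_S=0.$$
   Context: The letter $S$ also denotes the set of primes of $K$ lying above the primes in $S$. $U_{K,S}$ is the group of $S$-units of $K$. $\operatorname{Cl}(F)_S$ and $\operatorname{Cl}(K)_S$ are the $S$-ideal class groups of $F$ and $K$, i.e. the ideal class groups of the rings of $S$-integers of $F$ and $K$ (equivalently, the ideal class group modulo the subgroup generated by the classes of the non-archimedean primes in $S$). With $G=\operatorname{Gal}(K/F)$, the $S$-capitulation map $\epsilon_{K/F,S}:\operatorname{Cl}(F)_S\to(\operatorname{Cl}(K)_S)^G$ is the homomorphism induced by extension of ideals from $F$ to $K$. For a non-archimedean prime $\mathfrak p$ of $F$ and an integer $f\ge 1$, the relative Ostrowski ideal $\Pi_{\mathfrak p^f}(K/F)$ is the product of all prime ideals $\mathfrak P$ of $K$ with ideal norm $N_{K/F}(\mathfrak P)=\mathfrak p^f$ (and equals $\mathcal O_K$ if there are none). The $S$-relative Pólya group $\operatorname{Po}(K/F)_S$ is the subgroup of $\operatorname{Cl}(K)_S$ generated by the classes of all $\Pi_{\mathfrak p^f}(K/F)$ with $\mathfrak p$ a non-archimedean prime of $F$, $\mathfrak p\notin S$, $f\ge 1$. The $S$-relative Ostrowski quotient is $$\operatorname{Ost}(K/F)_S=\frac{\operatorname{Po}(K/F)_S}{\operatorname{Po}(K/F)_S\cap\epsilon_{K/F,S}(\operatorname{Cl}(F)_S)}.$$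 *)

(* Defs.v *)
From HB Require Import structures.
From mathcomp Require Import all_boot all_order all_algebra all_fingroup all_field.
From mathcomp Require Import finmap.
From mathcomp Require Import mathcomp_extra boolp classical_sets functions cardinality.

Set Implicit Arguments.
Unset Strict Implicit.
Unset Printing Implicit Defensive.

Import GRing.Theory.

Local Open Scope classical_set_scope.
Local Open Scope ring_scope.
Local Open Scope quotient_scope.

(** * Subgroups, kernels, quotients and H^1 for abelian groups

    All the abelian groups below are [zmodType]s, hence written additively,
    including ideal groups and unit groups. *)

Section Subgroup.
Variables (V : zmodType) (A : zmodClosed V).

Definition subgroup_of := {x : V | x \in A}.
HB.instance Definition _ := SubChoice.on subgroup_of.
HB.instance Definition _ := [SubChoice_isSubZmodule of subgroup_of by <:].

End Subgroup.

Section Generated.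
Variables (V : zmodType) (A : set V).

Definition generated : {pred V} :=
  fun x => `[< forall H : {pred V}, zmod_closed H ->
                 (forall y, A y -> y \in H) -> x \in H >].

Lemma generated_zmod_closed : zmod_closed generated.
Proof.
split; first by apply/asboolP => H [].
move=> x y /asboolP hx /asboolP hy; apply/asboolP => H cH AH.
by case: (cH) => _; apply; [apply: hx | apply: hy].
Qed.
HB.instance Definition _ :=
  GRing.isZmodClosed.Build V generated generated_zmod_closed.

End Generated.

Section KernelImage.
Variables (U V : zmodType) (f : {additive U -> V}).

Definition ker_pred : {pred U} := fun x => f x == 0.

Lemma ker_zmod_closed : zmod_closed ker_pred.
Proof.
split=> [|x y]; rewrite !unfold_in ?raddf0 // => /eqP fx /eqP fy.
by rewrite raddfB fx fy subrr.
Qed.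
HB.instance Definition _ := GRing.isZmodClosed.Build U ker_pred ker_zmod_closed.

Definition Ker := subgroup_of ker_pred.
HB.instance Definition _ := GRing.Zmodule.on Ker.

Definition im_pred : {pred V} := fun y => `[< exists x, f x = y >].

Lemma im_zmod_closed : zmod_closed im_pred.
Proof.
split=> [|x y]; first by apply/asboolP; exists 0; rewrite raddf0.
move=> /asboolP[a <-] /asboolP[b <-]; apply/asboolP.
by exists (a - b); rewrite raddfB.
Qed.
HB.instance Definition _ := GRing.isZmodClosed.Build V im_pred im_zmod_closed.

End KernelImage.

(** The quotient [A / (A :&: B)] of a subgroup [A] of [V], for [B] another
    subgroup of [V]. *)
Section QuotientInter.
Variables (V : zmodType) (A B : zmodClosed V).

Definition inter_pred : {pred subgroup_of A} := fun x => val x \in B.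

Lemma inter_zmod_closed : zmod_closed inter_pred.
Proof.
split=> [|x y]; rewrite -!topredE /= /inter_pred ?raddf0 ?rpred0 //.
by move=> xB yB; rewrite raddfB rpredB.
Qed.
HB.instance Definition _ :=
  GRing.isZmodClosed.Build (subgroup_of A) inter_pred inter_zmod_closed.

Definition quotient_inter := Quotient.quot inter_pred.
HB.instance Definition _ := ZmodQuotient.on quotient_inter.

End QuotientInter.

(** [act s] is meant to be an action on the right, [act (s * t) = act t \o act s],
    because this is the convention of [gal_of]: [(s * t) x = t (s x)].  In terms
    of the composition of automorphisms this is the usual cocycle condition
    f(t o s) = f(t) + t.f(s). *)
Section H1.
Variables (gT : finGroupType) (A : zmodType) (act : gT -> {additive A -> A}).

Definition cocycle : {pred {ffun gT -> A}} :=
  fun f => [forall s, forall t, f (s * t)%g == f t + act t (f s)].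

Lemma cocycle_zmod_closed : zmod_closed cocycle.
Proof.
split=> [|f g /'forall_forallP hf /'forall_forallP hg].
  by apply/'forall_forallP => s t; rewrite !ffunE raddf0 addr0.
apply/'forall_forallP => s t; rewrite !ffunE (eqP (hf s t)) (eqP (hg s t)).
by rewrite raddfB opprD addrACA.
Qed.
HB.instance Definition _ :=
  GRing.isZmodClosed.Build {ffun gT -> A} cocycle cocycle_zmod_closed.

Definition coboundary : {pred {ffun gT -> A}} :=
  fun f => `[< exists a, forall s, f s = act s a - a >].

Lemma coboundary_zmod_closed : zmod_closed coboundary.
Proof.
split=> [|f g /asboolP[a ha] /asboolP[b hb]]; apply/asboolP.
  by exists 0 => s; rewrite ffunE raddf0 subrr.
exists (a - b) => s; rewrite !ffunE ha hb raddfB !opprB.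
by rewrite addrACA [RHS]addrACA [- a + _]addrC.
Qed.
HB.instance Definition _ :=
  GRing.isZmodClosed.Build {ffun gT -> A} coboundary coboundary_zmod_closed.

Definition H1 := quotient_inter cocycle coboundary.
HB.instance Definition _ := ZmodQuotient.on H1.

End H1.

(** * S-integers and their ideal class group

    The definitions of this section make sense for any field [E], but they are
    meant for number fields. *)

Section Integers.
Variable E : fieldType.

Definition integers : set E := [set x | integralOver (intr : int -> E) x].

Record prime_ideal (P : set E) : Prop := PrimeIdeal {
  prime_ideal_sub : P `<=` integers;
  prime_ideal_neq0 : exists2 x, P x & x != 0;
  prime_idealB : forall x y, P x -> P y -> P (x - y);
  prime_idealM : forall a x, integers a -> P x -> P (a * x);
  prime_ideal1 : ~ P 1;
  prime_idealP : forall a b, integers a -> integers b -> P (a * b) -> P a \/ P b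
}.

(** Non-archimedean primes are the nonzero prime ideals of the ring of
    integers. *)
Record finite_prime := FinitePrime {
  pideal : set E;
  pidealP : prime_ideal pideal
}.

Lemma finite_prime_eq (P Q : finite_prime) : pideal P = pideal Q -> P = Q.
Proof.
case: P Q => [P hP] [Q hQ] /= PQ; case: _ / PQ hQ => hQ.
by rewrite (Prop_irrelevance hP hQ).
Qed.

Lemma integersB x y : integers x -> integers y -> integers (x - y).
Proof. exact: integral_sub. Qed.
Lemma integersM x y : integers x -> integers y -> integers (x * y).
Proof. exact: integral_mul. Qed.
Lemma integers_int (c : int) : integers c%:~R.
Proof. exact: integral_id. Qed.
Lemma integers1 : integers 1. Proof. exact: integral1. Qed.

(** Product of ideals: the finite sums of products. *)
Definition idmul (I J : set E) : set E :=
  [set x | exists2 s : seq (E * E),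
     forall p, p \in s -> I p.1 /\ J p.2 & x = \sum_(p <- s) p.1 * p.2].

Lemma idmul_mem (I J : set E) a b : I a -> J b -> idmul I J (a * b).
Proof.
move=> Ia Jb; exists [:: (a, b)]; last by rewrite big_seq1.
by move=> p; rewrite inE => /eqP->.
Qed.

Lemma idmul0 (I J : set E) : idmul I J 0.
Proof. by exists [::]; rewrite ?big_nil. Qed.

Lemma idmulD (I J : set E) x y : idmul I J x -> idmul I J y -> idmul I J (x + y).
Proof.
move=> [s hs ->] [t ht ->]; exists (s ++ t); last by rewrite big_cat.
by move=> p; rewrite mem_cat => /orP[/hs|/ht].
Qed.

Lemma idmul_ind (I J A : set E) : A 0 -> (forall x y, A x -> A y -> A (x + y)) ->
  (forall a b, I a -> J b -> A (a * b)) -> idmul I J `<=` A.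
Proof.
move=> A0 AD AM x [s hs ->]; elim: s hs => [|p s IHs] hs; first by rewrite big_nil.
rewrite big_cons; apply: AD; last by apply: IHs => q qs; apply: hs; rewrite inE qs orbT.
by apply: AM; have [] := hs p; rewrite // inE eqxx.
Qed.

Lemma idmulC (I J : set E) : idmul I J = idmul J I.
Proof.
apply/seteqP; split; apply: idmul_ind => *; rewrite 1?mulrC.
all: by [apply: idmul0 | apply: idmulD | apply: idmul_mem].
Qed.

Lemma idmulA (I J L : set E) : idmul I (idmul J L) = idmul (idmul I J) L.
Proof.
apply/seteqP; split; apply: idmul_ind; do ?[exact: idmul0 | exact: idmulD].
  move=> a b Ia; move: b; apply: idmul_ind => [|x y|x y Jx Ly].
  - by rewrite mulr0; apply: idmul0.
  - by rewrite mulrDr; apply: idmulD.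
  - by rewrite mulrA; do !apply: idmul_mem.
move=> a b + Lb; move: a; apply: idmul_ind => [|x y|x y Jx Ly].
- by rewrite mul0r; apply: idmul0.
- by rewrite mulrDl; apply: idmulD.
- by rewrite -mulrA; do !apply: idmul_mem.
Qed.

(** [idexp R I n] is the power I^n of an ideal of the ring [R]. *)
Definition idexp (R I : set E) (n : nat) : set E := iter n (idmul I) R.

End Integers.

Section ClassGroup.
Variables (E : fieldType) (T : set (finite_prime E)).

(** The ring of T-integers, as the intersection of the localizations of the ring
    of integers at the primes outside T. *)
Definition Tintegers : set E :=
  [set x | forall P, ~ T P ->
     exists s, [/\ integers s, ~ pideal P s & integers (s * x)]].

Lemma TintegersM x y : Tintegers x -> Tintegers y -> Tintegers (x * y).
Proof.
move=> hx hy P TP; have [s [Os Ps Osx]] := hx P TP; have [t [Ot Pt Oty]] := hy P TP.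
exists (s * t); split; first exact: integersM.
  by case/(prime_idealP (pidealP P)).
by rewrite mulrACA; apply: integersM.
Qed.

Lemma TintegersB x y : Tintegers x -> Tintegers y -> Tintegers (x - y).
Proof.
move=> hx hy P TP; have [s [Os Ps Osx]] := hx P TP; have [t [Ot Pt Oty]] := hy P TP.
exists (s * t); split; first exact: integersM.
  by case/(prime_idealP (pidealP P)).
rewrite mulrBr; apply: integersB; last by rewrite -mulrA; apply: integersM.
by rewrite mulrAC; apply: integersM.
Qed.

Lemma integers_Tintegers x : integers x -> Tintegers x.
Proof.
move=> Ox P _; exists 1; split; first exact: integers1.
  exact: prime_ideal1 (pidealP P).
by rewrite mul1r.
Qed.

Lemma Tintegers1 : Tintegers 1.
Proof. exact/integers_Tintegers/integers1. Qed.
Lemma Tintegers0 : Tintegers 0.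
Proof. by rewrite -(subrr 1); apply: TintegersB; apply: Tintegers1. Qed.
Lemma TintegersD x y : Tintegers x -> Tintegers y -> Tintegers (x + y).
Proof.
move=> hx hy; rewrite -[y]opprK -[- y]sub0r; apply: TintegersB => //.
by apply: TintegersB => //; apply: Tintegers0.
Qed.

(** ** The group of T-units *)

Definition Tunit_pred : {pred E} :=
  fun x => `[< [/\ x != 0, Tintegers x & Tintegers x^-1] >].
Definition Tunits := {x : E | x \in Tunit_pred}.
HB.instance Definition _ := SubChoice.on Tunits.

Lemma Tunit1 : 1 \in Tunit_pred.
Proof. by apply/asboolP; split; rewrite ?oner_neq0 ?invr1 //; apply: Tintegers1. Qed.
Lemma TunitM x y : x \in Tunit_pred -> y \in Tunit_pred -> x * y \in Tunit_pred.
Proof.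
move=> /asboolP[x0 hx hx'] /asboolP[y0 hy hy']; apply/asboolP.
by split; rewrite ?mulf_neq0 ?invfM //; apply: TintegersM.
Qed.
Lemma TunitV x : x \in Tunit_pred -> x^-1 \in Tunit_pred.
Proof.
by move=> /asboolP[x0 hx hx']; apply/asboolP; split; rewrite ?invr_eq0 ?invrK.
Qed.

(** The operation of [Tunits] is the multiplication of [E], written [+]. *)
Definition Tunits_one : Tunits := exist _ 1 Tunit1.
Definition Tunits_mul (x y : Tunits) : Tunits :=
  exist _ (val x * val y) (TunitM (valP x) (valP y)).
Definition Tunits_inv (x : Tunits) : Tunits :=
  exist _ (val x)^-1 (TunitV (valP x)).

Lemma Tunits_mulA : associative Tunits_mul.
Proof. by move=> x y z; apply: val_inj; rewrite /= mulrA. Qed.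
Lemma Tunits_mulC : commutative Tunits_mul.
Proof. by move=> x y; apply: val_inj; rewrite /= mulrC. Qed.
Lemma Tunits_mul1 : left_id Tunits_one Tunits_mul.
Proof. by move=> x; apply: val_inj; rewrite /= mul1r. Qed.
Lemma Tunits_mulV : left_inverse Tunits_one Tunits_inv Tunits_mul.
Proof.
move=> x; apply: val_inj; rewrite /= mulVf //.
by have /asboolP[] := valP x.
Qed.
HB.instance Definition _ := GRing.isZmodule.Build Tunits
  Tunits_mulA Tunits_mulC Tunits_mul1 Tunits_mulV.

(** ** The ideal class group of the ring of T-integers

    As usual for a general domain, it is the group of invertible fractional ideals
    modulo the principal ones; for a Dedekind domain, every nonzero fractional
    ideal is invertible. *)

Record fractional (I : set E) : Prop := Fractional {
  fractional0 : I 0;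
  fractionalD : forall x y, I x -> I y -> I (x + y);
  fractionalM : forall a x, Tintegers a -> I x -> I (a * x);
  fractional_denom :
    exists d, [/\ d != 0, Tintegers d & forall x, I x -> Tintegers (d * x)]
}.

Definition invertible_pred : {pred set E} := fun I =>
  `[< fractional I /\ exists2 J, fractional J & idmul I J = Tintegers >].

Definition ideal_group := {I : set E | I \in invertible_pred}.
HB.instance Definition _ := SubChoice.on ideal_group.

Lemma idmul1 I : fractional I -> idmul Tintegers I = I.
Proof.
case=> I0 ID IM _; apply/seteqP; split; first exact: idmul_ind.
by move=> x Ix; rewrite -[x]mul1r; apply: idmul_mem => //; apply: Tintegers1.
Qed.

Lemma fractional_one : fractional Tintegers.
Proof.
split; [exact: Tintegers0 | exact: TintegersD | exact: TintegersM |].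
exists 1; split; [exact: oner_neq0 | exact: Tintegers1 |].
by move=> x; rewrite mul1r.
Qed.

Lemma fractional_mul I J : fractional I -> fractional J -> fractional (idmul I J).
Proof.
move=> [I0 ID IM [d [d0 Rd hd]]] [J0 JD JM [e [e0 Re he]]].
split; [exact: idmul0 | exact: idmulD | |].
  move=> a x Ra; move: x; apply: idmul_ind => [|x y|x y Ix Jy].
  - by rewrite mulr0; apply: idmul0.
  - by rewrite mulrDr; apply: idmulD.
  - by rewrite mulrA; apply: idmul_mem => //; apply: IM.
exists (d * e); split; [exact: mulf_neq0 | exact: TintegersM |].
apply: idmul_ind => [|x y|x y Ix Jy].
- by rewrite mulr0; apply: Tintegers0.
- by rewrite mulrDr; apply: TintegersD.
- by rewrite mulrACA; apply: TintegersM; [apply: hd | apply: he].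
Qed.

Lemma invertible_one : Tintegers \in invertible_pred.
Proof.
apply/asboolP; split; first exact: fractional_one.
by exists Tintegers; [|rewrite idmul1 //]; exact: fractional_one.
Qed.

Lemma invertible_mul I J : I \in invertible_pred -> J \in invertible_pred ->
  idmul I J \in invertible_pred.
Proof.
move=> /asboolP[fI [I' fI' II']] /asboolP[fJ [J' fJ' JJ']]; apply/asboolP.
split; first exact: fractional_mul.
exists (idmul J' I'); first exact: fractional_mul.
rewrite -idmulA (idmulA J) JJ' idmul1 //.
Qed.

Lemma invertible_inv I : I \in invertible_pred ->
  {J | J \in invertible_pred & idmul J I = Tintegers}.
Proof.
move=> /asboolP hI; apply: cid2; case: hI => fI [J fJ IJ].
by exists J; rewrite 1?idmulC //; apply/asboolP; split=> //; exists I; rewrite 1?idmulC.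
Qed.

(** The operation of [ideal_group] is [idmul], written [+]. *)
Definition ideal_one : ideal_group := exist _ Tintegers invertible_one.
Definition ideal_mul (I J : ideal_group) : ideal_group :=
  exist _ (idmul (val I) (val J)) (invertible_mul (valP I) (valP J)).
Definition ideal_inv (I : ideal_group) : ideal_group :=
  let: exist2 J hJ _ := invertible_inv (valP I) in exist _ J hJ.

Lemma ideal_mulA : associative ideal_mul.
Proof. by move=> I J L; apply: val_inj; rewrite /= idmulA. Qed.
Lemma ideal_mulC : commutative ideal_mul.
Proof. by move=> I J; apply: val_inj; rewrite /= idmulC. Qed.
Lemma ideal_mul1 : left_id ideal_one ideal_mul.
Proof.
move=> I; apply: val_inj; rewrite /= idmul1 //.
by have /asboolP[] := valP I.
Qed.
Lemma ideal_mulV : left_inverse ideal_one ideal_inv ideal_mul.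
Proof.
by move=> I; apply: val_inj; rewrite /= /ideal_inv; case: invertible_inv.
Qed.
HB.instance Definition _ := GRing.isZmodule.Build ideal_group
  ideal_mulA ideal_mulC ideal_mul1 ideal_mulV.

Definition principal (a : E) : set E := [set a * x | x in Tintegers].

Lemma idmul_principal I a : fractional I ->
  idmul I (principal a) = [set a * x | x in I].
Proof.
move=> [I0 ID IM _]; apply/seteqP; split.
  apply: idmul_ind.
  - by exists 0; rewrite ?mulr0.
  - by move=> _ _ [x Ix <-] [y Iy <-]; exists (x + y); rewrite ?mulrDr //; apply: ID.
  - by move=> x _ Ix [y Ry <-]; exists (y * x); [apply: IM | rewrite mulrCA mulrC mulrCA mulrA].
move=> _ [x Ix <-]; rewrite mulrC; apply: idmul_mem => //.
by exists 1; rewrite ?mulr1 //; apply: Tintegers1.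
Qed.

Definition principal_pred : {pred ideal_group} := fun I =>
  `[< exists2 a, a != 0 & val I = principal a >].

Lemma principal_zmod_closed : zmod_closed principal_pred.
Proof.
split.
  apply/asboolP; exists 1; first exact: oner_neq0.
  by apply/seteqP; split=> [x Rx|_ [y Ry <-]]; rewrite ?mul1r //; exists x; rewrite ?mul1r.
move=> I J /asboolP[a a0 Ia] /asboolP[b b0 Jb]; apply/asboolP.
exists (a / b); first by rewrite mulf_neq0 ?invr_eq0.
have fM : fractional (val (I - J)) by have /asboolP[] := valP (I - J).
have : [set b * x | x in val (I - J)] = principal a.
  rewrite -idmul_principal // -Jb -Ia -[idmul _ _]/(val (I - J + J)).
  by rewrite subrK.
move=> /seteqP[h1 h2]; apply/seteqP; split=> [x Mx|_ [r Rr <-]].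
  have [|r Rr ar] := h1 (b * x); first by exists x.
  by exists r => //; rewrite mulrAC ar mulrAC mulfV ?mul1r.
have [|m Mm bm] := h2 (a * r); first by exists r.
by rewrite mulrAC -bm mulrAC mulfV ?mul1r.
Qed.
HB.instance Definition _ :=
  GRing.isZmodClosed.Build ideal_group principal_pred principal_zmod_closed.

Definition Cl := Quotient.quot principal_pred.
HB.instance Definition _ := ZmodQuotient.on Cl.

End ClassGroup.

(** * Extensions of number fields *)

Section RestrictPrime.
Variables (E E' : fieldType) (phi : {rmorphism E -> E'}).

Lemma integers_rmorph x : integers (phi x) <-> integers x.
Proof.
split=> [[p mp px]|[p mp px]]; exists p => //.
  move: px; rewrite (_ : map_poly _ p = map_poly phi (map_poly intr p)).
    by rewrite fmorph_root.
  by rewrite -map_poly_comp; apply: eq_map_poly => c /=; rewrite rmorph_int.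
rewrite (_ : map_poly _ p = map_poly phi (map_poly intr p)) ?fmorph_root //.
by rewrite -map_poly_comp; apply: eq_map_poly => c /=; rewrite rmorph_int.
Qed.

(** A nonzero ideal of the ring of integers contains a nonzero integer. *)
Lemma prime_ideal_int (P : set E') : prime_ideal P ->
  exists2 c : int, c != 0 & P c%:~R.
Proof.
move=> hP; have [x Px x0] := prime_ideal_neq0 hP.
have [p mp] := prime_ideal_sub hP Px; have := monic_neq0 mp; move: p {mp}.
apply: poly_ind => [|p c IHp]; first by rewrite eqxx.
have [->|c0] := eqVneq c 0.
  rewrite addr0 mulf_eq0 polyX_eq0 orbF => p0.
  by rewrite rmorphM /= map_polyX rootM rootX (negPf x0) orbF => /IHp; apply.
move=> _; rewrite rmorphD rmorphM /= map_polyX map_polyC /= /root hornerD hornerMX hornerC.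
rewrite addr_eq0 => /eqP px; exists c => //.
have -> : c%:~R = 0 - (map_poly intr p).[x] * x :> E' by rewrite px sub0r opprK.
apply: (prime_idealB hP).
  by rewrite -[X in P X](subrr x); apply: (prime_idealB hP).
apply: (prime_idealM hP) => //; apply: integral_horner; last exact: prime_ideal_sub Px.
by apply/integral_poly => i; rewrite coef_map; apply: integral_id.
Qed.

Lemma prime_ideal_comap (P : set E') : (forall c : int, c != 0 -> c%:~R != 0 :> E) ->
  prime_ideal P -> prime_ideal (phi @^-1` P).
Proof.
move=> charE hP; split.
- by move=> x /(prime_ideal_sub hP) /integers_rmorph.
- have [c c0 Pc] := prime_ideal_int hP; exists c%:~R; last exact: charE.
  by rewrite /= rmorph_int.
- by move=> x y Px Py; rewrite /= rmorphB; apply: (prime_idealB hP).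
- by move=> a x Oa Px; rewrite /= rmorphM; apply: (prime_idealM hP) => //; apply/integers_rmorph.
- by rewrite /= rmorph1; apply: prime_ideal1.
- move=> a b Oa Ob; rewrite /= rmorphM; apply: (prime_idealP hP).
    exact/integers_rmorph.
  exact/integers_rmorph.
Qed.

End RestrictPrime.

(** Archimedean primes are the embeddings into the complex numbers up to complex
    conjugation; all embeddings of a number field take their values in [algC]. *)
Record arch_prime (E : fieldType) := ArchPrime {
  embeddings : set {rmorphism E -> algC};
  embeddingsP : exists s : {rmorphism E -> algC},
    embeddings = [set t : {rmorphism E -> algC} | t =1 s \/ forall x, t x = (s x)^*]
}.

Inductive prime_of (E : fieldType) :=
  | Nonarch of finite_prime E
  | Arch of arch_prime E.

(** The number fields [F] and [K]: [F] is any finite extension of [rat] and [K] a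
    splitting field over [F], [in_alg K : x |-> x%:A] being the embedding of [F]
    into [K].  The automorphisms in [gal_of {:K}] are those of [K] over [F]. *)
Section Extension.
Variables (F : fieldExtType rat) (K : splittingFieldType F).

Lemma intr_base_neq0 (c : int) : c != 0 -> c%:~R != 0 :> F.
Proof. by move=> c0; rewrite -(rmorph_int (in_alg F)) fmorph_eq0 intr_eq0. Qed.

Lemma intr_ext_neq0 (c : int) : c != 0 -> c%:~R != 0 :> K.
Proof. by move=> c0; rewrite -(rmorph_int (in_alg K)) fmorph_eq0 intr_base_neq0. Qed.

Lemma algM (x y : F) : (x * y)%:A = x%:A * y%:A :> K.
Proof. exact: (rmorphM (in_alg K)). Qed.

Definition prime_below (P : finite_prime K) : finite_prime F :=
  FinitePrime (prime_ideal_comap (in_alg K) intr_base_neq0 (pidealP P)).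

(** The residue degree of [P] over [F]: the number of elements of a basis of
    O_K / P over O_F / (P :&: F), lifted to O_K. *)
Definition residue_basis (P : finite_prime K) (f : nat) (e : 'I_f -> K) : Prop :=
  [/\ forall i, integers (e i),
      forall x, integers x -> exists2 a : 'I_f -> F,
        forall i, integers (a i) & pideal P (x - \sum_i a i *: e i)
    & forall a : 'I_f -> F, (forall i, integers (a i)) ->
        pideal P (\sum_i a i *: e i) -> forall i, pideal (prime_below P) (a i)].

Definition residue_degree (P : finite_prime K) : nat :=
  xget 0%N [set f | exists e : 'I_f -> K, residue_basis P e].

Definition prime_norm (P : finite_prime K) : set F :=
  idexp (@integers F) (pideal (prime_below P)) (residue_degree P).

Definition is_ramification_index (P : finite_prime K) (e : nat) : Prop :=
  let pK := idmul (in_alg K @` pideal (prime_below P)) (@integers K) in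
  pK `<=` idexp (@integers K) (pideal P) e /\
  ~ (pK `<=` idexp (@integers K) (pideal P) e.+1).

(** Residue field extensions are separable, the residue fields being finite. *)
Definition unramified_at (p : finite_prime F) : Prop :=
  forall P, prime_below P = p -> is_ramification_index P 1.

(** The set of primes of [K] of norm [p ^ f] is finite, and [fset_set] enumerates
    it without repetition. *)
Definition Ostrowski_ideal (p : finite_prime F) (f : nat) : set K :=
  \big[@idmul K/@integers K]_(P <- fset_set (@pideal K @`
      [set P | prime_norm P = idexp (@integers F) (pideal p) f])) P.

Section Splaces.
Variable S : set (prime_of F).

Definition S_base : set (finite_prime F) := [set p | S (Nonarch p)].
Definition S_ext : set (finite_prime K) := [set P | S_base (prime_below P)].

(** Only non-archimedean primes are considered because [S] is meant to contain all
    the archimedean ones. *)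
Definition unramified_outside : Prop :=
  forall p, ~ S (Nonarch p) -> unramified_at p.

(** ** The S-capitulation map *)

Definition extend (I : set F) : set K := idmul (in_alg K @` I) (Tintegers S_ext).

Lemma Tintegers_in_alg x : Tintegers S_base x -> Tintegers S_ext x%:A.
Proof.
move=> hx P SP; have [s [Os Ps Osx]] := hx (prime_below P) SP.
exists s%:A; split=> //; first exact/(integers_rmorph (in_alg K)).
by rewrite -algM; apply/(integers_rmorph (in_alg K)).
Qed.

Lemma extend_mem (I : set F) x : I x -> extend I x%:A.
Proof.
move=> Ix; rewrite -[x%:A]mulr1; apply: idmul_mem; last exact: Tintegers1.
by exists x.
Qed.

Lemma extendM (I : set F) a x : Tintegers S_ext a -> extend I x -> extend I (a * x).
Proof.
move=> Ra; move: x; apply: idmul_ind => [|x y|x b Ix Rb].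
- by rewrite mulr0; apply: idmul0.
- by rewrite mulrDr; apply: idmulD.
- by rewrite mulrCA; apply: idmul_mem => //; apply: TintegersM.
Qed.

Lemma extend_fractional I : fractional S_base I -> fractional S_ext (extend I).
Proof.
move=> [I0 ID IM [d [d0 Rd hd]]]; split.
- exact: idmul0.
- exact: idmulD.
- by move=> a x; apply: extendM.
exists d%:A; split; first by rewrite (fmorph_eq0 (in_alg K)).
  exact: Tintegers_in_alg.
apply: idmul_ind => [|x y|_ b [x Ix <-] Rb].
- by rewrite mulr0; apply: Tintegers0.
- by rewrite mulrDr; apply: TintegersD.
- rewrite mulrA -algM; apply: TintegersM => //.
  exact/Tintegers_in_alg/hd.
Qed.

Lemma extend_mul I J : extend (idmul I J) = idmul (extend I) (extend J).
Proof.
apply/seteqP; split; apply: idmul_ind; do ?[exact: idmul0 | exact: idmulD].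
  move=> _ b [x IJx <-] Rb; move: x IJx.
  apply: (idmul_ind (A := [set x | idmul (extend I) (extend J) (x%:A * b)])) => /=.
  - by rewrite scale0r mul0r; apply: idmul0.
  - by move=> x y hx hy; rewrite scalerDl mulrDl; apply: idmulD.
  - move=> x y Ix Jy; rewrite algM -mulrA.
    by apply: idmul_mem; [apply: extend_mem | rewrite mulrC; apply: extendM => //; apply: extend_mem].
move=> a b Ia; move: b; apply: idmul_ind.
- by rewrite mulr0; apply: idmul0.
- by move=> x y; rewrite mulrDr; apply: idmulD.
move=> _ b [y Jy <-] Rb; move: a Ia; apply: idmul_ind.
- by rewrite mul0r; apply: idmul0.
- by move=> x z; rewrite mulrDl; apply: idmulD.
move=> _ c [x Ix <-] Rc; rewrite mulrACA -algM; apply: idmul_mem.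
  by exists (x * y) => //; apply: idmul_mem.
exact: TintegersM.
Qed.

Lemma extend_principal a : extend (principal S_base a) = principal S_ext a%:A.
Proof.
apply/seteqP; split.
  apply: idmul_ind.
  - by exists 0; rewrite ?mulr0 //; apply: Tintegers0.
  - by move=> _ _ [x Rx <-] [y Ry <-]; exists (x + y); rewrite ?mulrDr //; apply: TintegersD.
  - move=> _ b [_ [x Rx <-] <-] Rb; exists (x%:A * b); last by rewrite /= algM mulrA.
    by apply: TintegersM => //; apply: Tintegers_in_alg.
move=> _ [x Rx <-]; apply: idmul_mem => //; exists a => //.
by exists 1; rewrite ?mulr1 //; apply: Tintegers1.
Qed.

Lemma extend1 : extend (Tintegers S_base) = Tintegers S_ext.
Proof.
have H (E : fieldType) (T : set (finite_prime E)) : Tintegers T = principal T 1.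
  by apply/seteqP; split=> [x Rx|_ [y Ry <-]]; rewrite ?mul1r //; exists x; rewrite ?mul1r.
by rewrite H extend_principal scale1r -H.
Qed.

Lemma extend_invertible I :
  I \in invertible_pred S_base -> extend I \in invertible_pred S_ext.
Proof.
move=> /asboolP[fI [J fJ IJ]]; apply/asboolP; split; first exact: extend_fractional.
by exists (extend J); [apply: extend_fractional | rewrite -extend_mul IJ extend1].
Qed.

Definition extend_ideal (I : ideal_group S_base) : ideal_group S_ext :=
  exist _ (extend (val I)) (extend_invertible (valP I)).

Lemma extend_idealD : {morph extend_ideal : I J / I + J}.
Proof. by move=> I J; apply: val_inj; rewrite /= extend_mul. Qed.

(** The extended ideals are stable under the Galois group, so that [capitulation]
    takes its values in the classes fixed by the Galois group. *)
Definition capitulation (c : Cl S_base) : Cl S_ext :=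
  \pi_(Cl S_ext) (extend_ideal (generic_quotient.repr c)).

Lemma capitulation_pi I :
  capitulation (\pi_(Cl S_base) I) = \pi_(Cl S_ext) (extend_ideal I).
Proof.
have : generic_quotient.repr (\pi_(Cl S_base) I) - I \in principal_pred (T := S_base).
  by rewrite Quotient.idealrBE reprK.
move=> /asboolP[a a0 ha]; apply/eqP; rewrite /capitulation -Quotient.idealrBE.
apply/asboolP; exists a%:A; first by rewrite (fmorph_eq0 (in_alg K)).
rewrite -extend_principal -ha -[extend _]/(val (extend_ideal _)); congr val.
by apply/eqP; rewrite subr_eq -extend_idealD subrK.
Qed.

Lemma capitulation_zmod_morphism : zmod_morphism capitulation.
Proof.
move=> x y; rewrite -[x]reprK -[y]reprK -raddfB !capitulation_pi -raddfB.
by congr (\pi _); apply/eqP; rewrite eq_sym subr_eq -extend_idealD subrK.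
Qed.
HB.instance Definition _ := GRing.isZmodMorphism.Build (Cl S_base) (Cl S_ext)
  capitulation capitulation_zmod_morphism.

(** ** The Galois module of S-units of K *)

Lemma prime_below_gal (s : gal_of {:K}) (P Q : finite_prime K) :
  pideal Q = s @^-1` pideal P -> prime_below Q = prime_below P.
Proof.
move=> QP; apply: finite_prime_eq; rewrite /= QP.
by apply/seteqP; split=> x /=; rewrite linearZ /= rmorph1.
Qed.

Lemma Tintegers_gal (s : gal_of {:K}) x : Tintegers S_ext x -> Tintegers S_ext (s x).
Proof.
move=> hx P SP.
pose Q := FinitePrime (prime_ideal_comap s intr_ext_neq0 (pidealP P)).
have QP : prime_below Q = prime_below P by exact: (@prime_below_gal s).
have [|t [Ot Qt Otx]] := hx Q; first by rewrite /S_ext /= QP.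
exists (s t); split; [exact/(integers_rmorph s) | exact: Qt |].
by rewrite -rmorphM; apply/(integers_rmorph s).
Qed.

Lemma extend_gal (s : gal_of {:K}) I x : extend I x -> extend I (s x).
Proof.
move: x; apply: (idmul_ind (A := [set x | extend I (s x)])) => /=.
- by rewrite rmorph0; apply: idmul0.
- by move=> x y hx hy; rewrite rmorphD; apply: idmulD.
- move=> _ b [a Ia <-] Rb; rewrite rmorphM /= linearZ /= rmorph1.
  by apply: idmul_mem; [exists a | apply: Tintegers_gal].
Qed.

Lemma Tunit_gal (s : gal_of {:K}) x :
  x \in Tunit_pred S_ext -> s x \in Tunit_pred S_ext.
Proof.
move=> /asboolP[x0 hx hx']; apply/asboolP; split; first by rewrite fmorph_eq0.
  exact: Tintegers_gal.
by rewrite -fmorphV; apply: Tintegers_gal.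
Qed.

Definition Sunits := Tunits S_ext.
HB.instance Definition _ := GRing.Zmodule.on Sunits.

Definition gal_Sunits (s : gal_of {:K}) (u : Sunits) : Sunits :=
  exist _ (s (val u)) (Tunit_gal s (valP u)).

Lemma gal_Sunits_zmod_morphism s : zmod_morphism (gal_Sunits s).
Proof. by move=> u v; apply: val_inj; rewrite /= rmorphM fmorphV. Qed.
HB.instance Definition _ s := GRing.isZmodMorphism.Build Sunits Sunits
  (gal_Sunits s) (gal_Sunits_zmod_morphism s).

Definition H1_Sunits := H1 gal_Sunits.
HB.instance Definition _ := ZmodQuotient.on H1_Sunits.

(** ** The relative Polya group and the Ostrowski quotient *)

(** The class in Cl(K)_S of an ideal of O_K is that of the ideal it generates in the
    ring of S-integers; this ideal is always invertible here, so that each pair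
    [(p, f)] contributes exactly one generator. *)
Definition Polya_gen : set (Cl S_ext) := [set c |
  exists p f (I : ideal_group S_ext),
    [/\ ~ S (Nonarch p), (0 < f)%N,
        val I = idmul (Ostrowski_ideal p f) (Tintegers S_ext)
      & c = \pi_(Cl S_ext) I]].

(** The subgroup Po(K/F)_S of Cl(K)_S is [generated Polya_gen]. *)
Definition Ost := quotient_inter (generated Polya_gen) (im_pred capitulation).
HB.instance Definition _ := ZmodQuotient.on Ost.

End Splaces.
End Extension.

Arguments capitulation {F} K S.
Arguments Ost {F} K S.

(* Main.v *)
From HB Require Import structures.
Require Import Defs.
From mathcomp Require Import all_boot all_order all_algebra all_fingroup all_field.
From mathcomp Require Import finmap.
From mathcomp Require Import mathcomp_extra boolp classical_sets functions cardinality.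
From mathcomp Require Import ring.

Set Implicit Arguments.
Unset Strict Implicit.
Unset Printing Implicit Defensive.

Import GRing.Theory.

Local Open Scope classical_set_scope.
Local Open Scope ring_scope.
Local Open Scope quotient_scope.

(** Write [R] for the ring of S-integers of [K] and [G] for the Galois group. As [K] is
    unramified outside [S], the ring [R] is a Galois extension of the ring of
    S-integers of [F]: there are [x_i] and [y_i] in [R] such that the sum of the
    [x_i s(y_i)] is [1] if [s = 1] and [0] for every other [s] in [G]
    ([tensor_fun_delta]). If [J] is a [G]-stable fractional ideal of [R], every [m] in
    [J] is then the sum of the [x_i Tr(y_i m)], in which the traces lie in [J] and in
    [F] ([galois_descent]). Hence every [G]-stable invertible ideal of [R] is the
    extension of an invertible ideal of [F] ([invertible_descent]), and both
    conclusions follow from this.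

    Conjugate primes have the same norm, so the Ostrowski ideals are [G]-stable. The
    generators of the Polya group are therefore classes of extended ideals, and the
    Ostrowski quotient vanishes.

    If an ideal [I] of [F] becomes principal, [I R = a R], then [s |-> s(a) / a] is a
    cocycle with values in the units of [R], and its cohomology class depends only on
    the class of [I]. When [s(a) / a = s(u) / u] for a unit [u], the generator [a / u]
    of [I R] lies in [F] and generates [I] ([gal_quotient_coboundary]). Conversely, by
    Hilbert 90, every cocycle of units has the form [s(a) / a] with [a] in [K]; the
    ideal [a R] is then [G]-stable, hence extended from [F] ([cocycle_gal_quotient]).

    The [x_i] and [y_i] exist because, for each [s] other than [1], the differences
    [y - s(y)] generate the unit ideal of [R] ([unramified_differences]): otherwise
    they would all lie in a prime [P] outside [S]. As the ramification index is [1],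
    [P] is locally generated by an element of [F]. It is fixed by [s], and [s] acts
    trivially on the finite field of residues modulo [P]; this forces [s(r) - r] to
    lie in all the powers of [P], and [s = 1] ([inertia_trivial]).

    The arithmetic of number fields enters through one finiteness property: if [A] is
    an additive subgroup of a number field and [m] a nonzero integer, [A / m A] is
    finite ([pigeonhole_mod]). It makes residue rings finite, almost integral elements
    integral, and primes locally principal ([prime_locally_principal]). *)

(** * Additive subgroups of a number field modulo an integer *)

(** Characteristic zero and finite degree. Expressing the degree by relations with
    integral coefficients treats [F] and [K] alike, without reference to a base field. *)
Record number_field (E : fieldType) : Prop := NumberField {
  intr_neq0 : forall c : int, c != 0 -> c%:~R != 0 :> E;
  int_relation : exists N, forall x : nat -> E, exists2 c : nat -> int,
    exists2 i, (i < N)%N & c i != 0 & \sum_(i < N) (c i)%:~R * x i = 0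
}.

Record subgroup (E : fieldType) (A : set E) : Prop := Subgroup {
  subgroup0 : A 0;
  subgroupB : forall x y, A x -> A y -> A (x - y)
}.

Section Subgroup.
Variables (E : fieldType) (A : set E) (hA : subgroup A).

Lemma subgroupN x : A x -> A (- x).
Proof. by move=> Ax; rewrite -sub0r; apply: subgroupB => //; apply: subgroup0. Qed.

Lemma subgroupD x y : A x -> A y -> A (x + y).
Proof.
by move=> Ax Ay; rewrite -[y]opprK; apply: subgroupB => //; apply: subgroupN.
Qed.

Lemma subgroup_sum (I : Type) (s : seq I) (P : pred I) (f : I -> E) :
  (forall i, P i -> A (f i)) -> A (\sum_(i <- s | P i) f i).
Proof.
move=> hf; elim/big_ind: _ => //; first exact: subgroup0.
exact: subgroupD.
Qed.

Lemma subgroupMn x n : A x -> A (x *+ n).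
Proof.
move=> Ax; elim: n => [|n IHn]; first exact: subgroup0.
by rewrite mulrS; apply: subgroupD.
Qed.

Lemma subgroup_intM (c : int) x : A x -> A (c%:~R * x).
Proof.
move=> Ax; rewrite mulrzl; case: c => n; first exact: subgroupMn.
by rewrite NegzE mulrNz; apply/subgroupN/subgroupMn.
Qed.

End Subgroup.

Section FiniteQuotient.
Variables (E : fieldType) (hE : number_field E).
Variables (A : set E) (hA : subgroup A).

(** Dividing out common factors [l], an integral relation can be made nonzero modulo
    the prime [l]. *)
Lemma int_relation_mod (l : nat) : prime l -> exists N, forall x : nat -> E,
  exists2 c : nat -> int, exists2 i, (i < N)%N & ~~ (l %| c i)%Z
    & \sum_(i < N) (c i)%:~R * x i = 0.
Proof.
move=> l_pr; have [N hN] := int_relation hE; exists N => x.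
have [c [i iN ci0] cx] := hN x.
have [n] := ubnP `|c i|%N; elim: n c ci0 cx => // n IHn c ci0 cx lecn.
have [hc|/existsNP[j]] := pselect (forall j, (j < N)%N -> (l %| c j)%Z); last first.
  by move/not_implyP=> [jN /negP hj]; exists c => //; exists j.
pose d j := (c j %/ l)%Z.
have dE j : (j < N)%N -> c j = d j * l by move=> /hc /divzK ->.
have l0 : l%:Z != 0 by rewrite -lt0n prime_gt0.
have di0 : d i != 0 by apply: contraNneq ci0 => di; rewrite dE // di mul0r.
apply: (IHn d) => //.
  apply: (mulfI (intr_neq0 hE l0)); rewrite mulr0 -[RHS]cx mulr_sumr.
  by apply: eq_bigr => j _; rewrite mulrA -intrM [_ * d j]mulrC -dE.
rewrite -ltnS (leq_trans _ lecn) // ltnS [in X in (_ < X)%N]dE // abszM.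
by rewrite -[X in (X < _)%N]muln1 ltn_pmul2l ?absz_gt0 //= prime_gt1.
Qed.

Definition finite_mod (m : nat) := exists2 L : seq E, forall l, l \in L -> A l
  & forall x, A x -> exists2 l, l \in L & exists2 z, A z & x = l + m%:R * z.

(** A family of elements of [A] that are independent modulo [l] has fewer elements than
    the bound on integral relations; a maximal one spans [A] modulo [l]. *)
Lemma finite_mod_prime l : prime l -> finite_mod l.
Proof.
move=> l_pr; have [N hN] := int_relation_mod l_pr.
have l0 : l%:Z != 0 by rewrite -lt0n prime_gt0.
pose indep (xs : seq E) := forall (c : nat -> int) z, A z ->
  \sum_(i < size xs) (c i)%:~R * xs`_i = l%:R * z ->
  forall i, (i < size xs)%N -> (l %| c i)%Z.
suff H n xs : (forall x, x \in xs -> A x) -> indep xs -> (size xs + n = N)%N ->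
    finite_mod l.
  apply: (H N [::]) => //; by move=> c z _ _ i; rewrite ltn0.
elim: n xs => [|n IHn] xs Axs ixs szxs.
  rewrite addn0 in szxs; have [c [i iN ci] cx] := hN (nth 0 xs).
  case/negP: ci; apply: (ixs c 0); rewrite ?szxs //; first exact: subgroup0.
  by rewrite mulr0.
have [spans|/existsNP[x /not_implyP[Ax nspan]]] :=
  pselect (forall x, A x -> exists c : nat -> int, exists2 z, A z &
             x = \sum_(i < size xs) (c i)%:~R * xs`_i + l%:R * z).
  exists [seq \sum_i (c i)%:R * xs`_i | c : {ffun 'I_(size xs) -> 'I_l}].
    move=> _ /mapP[c _ ->]; apply: subgroup_sum => // i _.
    rewrite -[(c i)%:R]/((c i)%:Z%:~R); apply: subgroup_intM => //.
    exact/Axs/mem_nth.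
  move=> x /spans[c [z Az ->]].
  have cl i : (`|(c i %% l)%Z|%N < l)%N.
    rewrite -ltz_nat gez0_abs ?modz_ge0 //.
    by rewrite (ltz_pmod (c i)) // ltz_nat prime_gt0.
  exists (\sum_(i < size xs) (Ordinal (cl i))%:R * xs`_i).
    apply/mapP; exists [ffun i : 'I_(size xs) => Ordinal (cl i)].
      by rewrite mem_enum.
    by apply: eq_bigr => i _; rewrite ffunE.
  exists (\sum_(i < size xs) (c i %/ l)%Z%:~R * xs`_i + z).
    apply: subgroupD => //; apply: subgroup_sum => // i _.
    by apply: subgroup_intM => //; apply/Axs/mem_nth.
  rewrite mulrDr addrA; congr (_ + _); rewrite mulr_sumr -big_split /=.
  apply: eq_bigr => i _; rewrite {1}(divz_eq (c i) l) intrD intrM.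
  have <- : `|(c i %% l)%Z|%N%:R = (c i %% l)%Z%:~R :> E.
    by rewrite -[LHS]/(`|(c i %% l)%Z|%N%:Z%:~R) gez0_abs ?modz_ge0.
  by rewrite -[l%:~R]/(l%:R) mulrDl addrC mulrA [l%:R * _]mulrC.
apply: (IHn (x :: xs)); rewrite ?addSnnS //.
  by move=> y; rewrite inE => /orP[/eqP->|/Axs].
move=> c z Az; rewrite /= big_ord_recl /= => cz.
have lc0 : (l %| c 0%N)%Z.
  apply/negPn/negP => lc0; apply: nspan.
  have /coprimezP[[d e] /= de] : coprimez (c 0%N) l.
    by rewrite coprimez_sym coprimezE prime_coprime.
  have /(congr1 (intr : int -> E)) := de; rewrite intrD !intrM mulr1z => deE.
  exists (fun i => - d * c i.+1), (d%:~R * z + e%:~R * x).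
    by apply: subgroupD => //; apply: subgroup_intM.
  have -> : \sum_(i < size xs) (- d * c i.+1)%:~R * xs`_i
      = - d%:~R * \sum_(i < size xs) (c i.+1)%:~R * xs`_i :> E.
    by rewrite mulr_sumr; apply: eq_bigr => i _; rewrite intrM mulrNz mulrA.
  have -> : \sum_(i < size xs) (c i.+1)%:~R * xs`_i = l%:R * z - (c 0%N)%:~R * x.
    by rewrite -cz [RHS]addrC addKr.
  rewrite -[LHS]mul1r -[X in X * x = _]deE -[l%:~R]/(l%:R); ring.
case=> [_|i lti] //.
have /dvdzP[q qE] := lc0.
apply: (ixs (fun i => c i.+1) (z - q%:~R * x)) => //.
  by apply: subgroupB => //; apply: subgroup_intM.
by rewrite mulrBr -cz qE intrM -[l%:~R]/(l%:R); ring.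
Qed.

(** A product of primes is reached by lifting residues digit by digit. *)
Lemma finite_mod_pos m : (0 < m)%N -> finite_mod m.
Proof.
have [n] := ubnP m; elim: n m => // n IHn m lemn m_gt0.
have [m_le1|m_gt1] := leqP m 1.
  have -> : m = 1%N by apply/eqP; rewrite eqn_leq m_le1.
  exists [:: 0]; first by move=> l; rewrite inE => /eqP->; apply: subgroup0.
  by move=> x Ax; exists 0; rewrite ?inE //; exists x; rewrite ?mul1r ?add0r.
have l_pr := pdiv_prime m_gt1; have /dvdnP[m' mE] := pdiv_dvd m.
have m'_gt0 : (0 < m')%N by move: m_gt0; rewrite mE muln_gt0 => /andP[].
have [|L LA hL] := IHn m' _ m'_gt0.
  rewrite -ltnS (leq_trans _ lemn) // ltnS mE -[X in (X < _)%N]muln1.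
  by rewrite ltn_pmul2l // prime_gt1.
have [L' LA' hL'] := finite_mod_prime l_pr.
exists [seq l + m'%:R * l' | l <- L, l' <- L'].
  move=> _ /allpairsP[[l l'] /= [/LA Al /LA' Al' ->]]; apply: subgroupD => //.
  exact: (subgroup_intM hA m').
move=> x /hL[l Ll [z /hL'[l' Ll' [z' Az' ->]] ->]].
exists (l + m'%:R * l'); first by apply/allpairsP; exists (l, l').
by exists z' => //; rewrite {2}mE natrM; ring.
Qed.

Lemma finite_mod_neq0 (m : int) : m != 0 -> exists2 L : seq E,
  forall l, l \in L -> A l
  & forall x, A x -> exists2 l, l \in L & exists2 z, A z & x = l + m%:~R * z.
Proof.
move=> m0; have [|L LA hL] := @finite_mod_pos `|m|; first by rewrite absz_gt0.
exists L => // x /hL[l Ll [z Az ->]]; exists l => //; case: m {m0 hL} => n /=.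
  by exists z.
by exists (- z); [apply: subgroupN | rewrite NegzE mulrNz mulrNN].
Qed.

(** Applied below to sequences of powers, of iterates of Frobenius and of quotients by
    powers of a uniformizer. *)
Lemma pigeonhole_mod (m : int) (f : nat -> E) : m != 0 -> (forall i, A (f i)) ->
  exists i j, (i < j)%N /\ exists2 z, A z & f i - f j = m%:~R * z.
Proof.
move=> /finite_mod_neq0[L _ hL] Af.
have [g hg] : {g : nat -> E & forall i, g i \in L /\ exists2 z, A z & f i = g i + m%:~R * z}.
  apply: (@choice _ _ (fun i l => l \in L /\ exists2 z, A z & f i = l + m%:~R * z)).
  by move=> i; have [l Ll hl] := hL _ (Af i); exists l.
have : ~~ uniq [seq g i | i <- iota 0 (size L).+1].
  apply: contraTN isT => /uniq_leq_size sz.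
  suff /sz : {subset [seq g i | i <- iota 0 (size L).+1] <= L}.
    by rewrite size_map size_iota ltnn.
  by move=> _ /mapP[i _ ->]; have [] := hg i.
move/(uniqPn 0) => [i [j []]]; rewrite size_map size_iota => ij jL.
rewrite !(nth_map 0%N) ?size_iota ?(ltn_trans ij) // !nth_iota ?(ltn_trans ij) //.
rewrite !add0n => gij; exists i, j; split=> //.
have [_ [z Az ->]] := hg i; have [_ [w Aw ->]] := hg j.
by exists (z - w); [apply: subgroupB|rewrite gij; ring].
Qed.

End FiniteQuotient.

(** * Ideals and maximal ideals *)

Record subring (E : fieldType) (R : set E) : Prop := Subring {
  subring1 : R 1;
  subringB : forall x y, R x -> R y -> R (x - y);
  subringM : forall x y, R x -> R y -> R (x * y)
}.

Record ideal (E : fieldType) (R I : set E) : Prop := Ideal {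
  ideal_sub : I `<=` R;
  ideal_subgroup : subgroup I;
  idealM : forall a x, R a -> I x -> I (a * x)
}.

Section Subring.
Variables (E : fieldType) (R : set E) (hR : subring R).

Lemma subring_subgroup : subgroup R.
Proof.
split; last exact: (subringB hR).
by rewrite -(subrr 1); apply: (subringB hR); apply: (subring1 hR).
Qed.

Lemma subringD x y : R x -> R y -> R (x + y).
Proof. exact: (subgroupD subring_subgroup). Qed.

Lemma subringX x n : R x -> R (x ^+ n).
Proof.
move=> Rx; elim: n => [|n IHn]; first exact: (subring1 hR).
by rewrite exprS; apply: (subringM hR).
Qed.

Lemma subring_prod (I : Type) (s : seq I) (P : pred I) (f : I -> E) :
  (forall i, P i -> R (f i)) -> R (\prod_(i <- s | P i) f i).
Proof.
move=> hf; elim/big_ind: _ => //; first exact: (subring1 hR).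
exact: (subringM hR).
Qed.

Lemma ideal_idmul I : I `<=` R -> ideal R (idmul I R).
Proof.
move=> IR; have hI a x : R a -> idmul I R x -> idmul I R (a * x).
  move=> Ra; move: x; apply: idmul_ind => [|x y|x y Ix Ry].
  - by rewrite mulr0; apply: idmul0.
  - by rewrite mulrDr; apply: idmulD.
  - by rewrite mulrCA; apply: idmul_mem => //; apply: (subringM hR).
split=> //.
  apply: idmul_ind => [|x y|x y Ix Ry]; first exact: (subgroup0 subring_subgroup).
    exact: subringD.
  exact: (subringM hR) (IR _ Ix) Ry.
split=> [|x y Ix Iy]; first exact: idmul0.
apply: idmulD => //; rewrite -mulN1r; apply: hI => //.
by apply: (subgroupN subring_subgroup); apply: (subring1 hR).
Qed.

Lemma idealMr I x a : ideal R I -> I x -> R a -> I (x * a).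
Proof. by move=> hI Ix Ra; rewrite mulrC; apply: (idealM hI). Qed.

Lemma maximal_ideal I : ideal R I -> ~ I 1 -> exists M, [/\ ideal R M, I `<=` M, ~ M 1
  & forall a, R a -> ~ M a -> exists2 b, R b & M (1 - a * b)].
Proof.
move=> hI I1.
pose proper M := [/\ ideal R M, I `<=` M & ~ M 1].
have properI : proper I by split.
(* The empty set is admitted as the union of the empty chain. *)
have [|M [[->|[hM IM M1]] maxM]] := @Zorn_bigcup E (fun M => M = set0 \/ proper M).
- move=> C CP totC.
  have [[M0 CM0 pM0]|noP] := pselect (exists2 M, C M & proper M); last first.
    left; apply: contrapT => /eqP/set0P[x [M CM Mx]].
    have [M0|pM] := CP _ CM; first by rewrite M0 in Mx.
    by apply: noP; exists M.
  have hC M x : C M -> M x -> ideal R M /\ ~ M 1.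
    by move=> CM Mx; have [M0'|[]//] := CP _ CM; rewrite M0' in Mx.
  right; have [hM0 IM0 M01] := pM0; split.
  + split=> [x [M CM Mx]||a x Ra [M CM Mx]].
    * by have [hM _] := hC _ _ CM Mx; apply: (ideal_sub hM).
    * split=> [|x y [M CM Mx] [N CN Ny]].
        by exists M0 => //; apply: (subgroup0 (ideal_subgroup hM0)).
      have [hM _] := hC _ _ CM Mx; have [hN _] := hC _ _ CN Ny.
      have [MN|NM] := totC _ _ CM CN.
        by exists N => //; apply: (subgroupB (ideal_subgroup hN)) => //; apply: MN.
      by exists M => //; apply: (subgroupB (ideal_subgroup hM)) => //; apply: NM.
    * by exists M => //; have [hM _] := hC _ _ CM Mx; apply: (idealM hM).
  + by move=> x Ix; exists M0 => //; apply: IM0.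
  + by move=> [M CM M1]; have [_] := hC _ _ CM M1.
- case: (maxM I); last by right.
  split; first by [].
  by move=> /(_ 0); apply; apply: (subgroup0 (ideal_subgroup hI)).
exists M; split=> // a Ra Ma.
pose N := [set x | exists2 m, M m & exists2 b, R b & x = m + a * b].
have R0 := subgroup0 subring_subgroup.
have M0 := subgroup0 (ideal_subgroup hM).
have MN : M `<=` N by move=> x Mx; exists x => //; exists 0; rewrite ?mulr0 ?addr0.
have [[m Mm [b Rb abm]]|N1] := pselect (N 1).
  by exists b => //; rewrite abm addrK.
case: (maxM N).
  split=> //; move=> /(_ a) NM; apply: Ma; apply: NM.
  by exists 0 => //; exists 1; [apply: (subring1 hR) | rewrite mulr1 add0r].
right; split=> //; last by move=> x /IM /MN.
split.
- move=> _ [m /(ideal_sub hM) Rm [b Rb ->]].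
  by apply: subringD => //; apply: (subringM hR).
- split=> [|_ _ [m Mm [b Rb ->]] [n Mn [c Rc ->]]]; first exact: MN.
  exists (m - n); first exact: (subgroupB (ideal_subgroup hM) Mm Mn).
  by exists (b - c); [apply: (subringB hR) | ring].
- move=> c _ Rc [m Mm [b Rb ->]]; exists (c * m); first exact: (idealM hM).
  by exists (c * b); [apply: (subringM hR) | ring].
Qed.

Lemma maximal_ideal_prime M : ideal R M ->
  (forall a, R a -> ~ M a -> exists2 b, R b & M (1 - a * b)) ->
  forall a b, R a -> R b -> M (a * b) -> M a \/ M b.
Proof.
move=> hM maxM a b Ra Rb Mab; have [|/(maxM _ Ra)[c Rc Mc]] := pselect (M a); first by left.
right; have -> : b = b * (1 - a * c) + c * (a * b) by ring.
by apply: (subgroupD (ideal_subgroup hM)); apply: (idealM hM).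
Qed.

End Subring.

(** * Primes of the ring of integers of a number field *)

Section Integers.
Variables (E : fieldType).
Local Notation O := (@integers E).

Lemma integers_subring : subring O.
Proof. by split; [exact: integers1 | exact: integersB | exact: integersM]. Qed.
Local Notation Osubgroup := (subring_subgroup integers_subring).

Lemma integersN x : O x -> O (- x). Proof. exact: (subgroupN Osubgroup). Qed.
Lemma integersD x y : O x -> O y -> O (x + y). Proof. exact: (subgroupD Osubgroup). Qed.
Lemma integersX x n : O x -> O (x ^+ n). Proof. exact: (subringX integers_subring). Qed.
Lemma integers0 : O 0. Proof. exact: (subgroup0 Osubgroup). Qed.

(** The constant coefficient of an integral equation for [x] is a multiple of [x]; it is
    nonzero once the powers of the variable have been factored out. *)
Lemma integer_multiple x : O x -> x != 0 ->
  exists2 c : int, c != 0 & exists2 y, O y & c%:~R = x * y.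
Proof.
move=> Ox x0; have [p mp] := Ox; have := monic_neq0 mp; move: p {mp}.
apply: poly_ind => [|p c IHp]; first by rewrite eqxx.
have [->|c0] := eqVneq c 0.
  rewrite addr0 mulf_eq0 polyX_eq0 orbF => p0.
  by rewrite rmorphM /= map_polyX rootM rootX (negPf x0) orbF => /IHp; apply.
move=> _; rewrite rmorphD rmorphM /= map_polyX map_polyC /= /root hornerD hornerMX hornerC.
rewrite addr_eq0 => /eqP px; exists c => //.
exists (- (map_poly intr p).[x]).
  apply/integersN/integral_horner => //.
  by apply/integral_poly => i; rewrite coef_map; apply: integral_id.
by rewrite mulrN mulrC px opprK.
Qed.

Section Prime.
Variables (P : set E) (hP : prime_ideal P).

Lemma prime_ideal_ideal : ideal O P.
Proof.
split; [exact: (prime_ideal_sub hP) | | exact: prime_idealM hP].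
split; last exact: (prime_idealB hP).
have [x Px _] := prime_ideal_neq0 hP.
by rewrite -(subrr x); apply: prime_idealB.
Qed.
Local Notation Psubgroup := (ideal_subgroup prime_ideal_ideal).

Lemma primeD x y : P x -> P y -> P (x + y).
Proof. exact: (subgroupD Psubgroup). Qed.

Lemma primeM_notin u v : O u -> O v -> ~ P u -> ~ P v -> ~ P (u * v).
Proof. by move=> Ou Ov Pu Pv /(prime_idealP hP Ou Ov)[]. Qed.

Lemma primeX x n : O x -> P (x ^+ n) -> P x.
Proof.
move=> Ox; elim: n => [/(prime_ideal1 hP)|n IHn] //.
by rewrite exprS => /(prime_idealP hP Ox (integersX n Ox))[].
Qed.

Lemma prime_1Bnotin x : P x -> O (1 - x) /\ ~ P (1 - x).
Proof.
move=> Px; split; first by apply: integersB; [exact: integers1 | exact: prime_ideal_sub Px].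
by move=> /(primeD Px); rewrite addrC subrK; apply: prime_ideal1.
Qed.

End Prime.

Hypothesis hE : number_field E.

(** If [x ^ i] and [x ^ j] agree modulo [P], for [i < j], then [x ^ (j - i)] is [1]
    modulo [P]. *)
Lemma prime_maximal P : prime_ideal P -> forall x, O x -> ~ P x ->
  exists2 y, O y & P (1 - x * y).
Proof.
move=> hP x Ox Px; have [c c0 Pc] := prime_ideal_int hP.
have [i [j [ij [z Oz fij]]]] :=
  pigeonhole_mod hE Osubgroup c0 (fun i => integersX i Ox).
exists (x ^+ (j - i).-1); first exact: integersX.
rewrite -exprS prednK ?subn_gt0 //.
have : P (x ^+ i * (1 - x ^+ (j - i))).
  rewrite mulrBr mulr1 -exprD subnKC ?fij 1?ltnW // mulrC.
  exact: (prime_idealM hP).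
case/(prime_idealP hP) => //; first exact: integersX.
  by apply: integersB; [exact: integers1 | exact: integersX].
by move/(primeX hP Ox)/Px.
Qed.

(** If [c g^i] and [c g^j] agree modulo [c], then [g] is a root of a monic trinomial
    with integral coefficients. *)
Lemma almost_integral (c : int) g : c != 0 -> (forall k, O (c%:~R * g ^+ k)) -> O g.
Proof.
move=> c0 Og; have [i [j [ij [z Oz]]]] := pigeonhole_mod hE Osubgroup c0 Og.
rewrite -mulrBr => /(mulfI (intr_neq0 hE c0)) gij.
have sz : (size ('X^i - z%:P : {poly E})%R < j.+1)%N.
  rewrite ltnS (leq_trans (size_polyD _ _)) // geq_max size_polyXn ij size_polyN.
  by rewrite (leq_trans (size_polyC_leq1 _)) // (leq_ltn_trans _ ij).
apply: (@integral_root_monic _ _ _ _ ('X^j - ('X^i - z%:P))).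
- by rewrite monicE lead_coefDl ?lead_coefXn // size_polyN size_polyXn.
- by rewrite rootE !hornerE -gij; apply/eqP; ring.
- apply/integral_poly => k; rewrite !coefE.
  do !apply: integral_sub; try exact: integral_nat.
  by case: eqP => _ //; apply: integral0.
Qed.

Section LocallyPrincipal.
Variables (P : set E) (hP : prime_ideal P) (pi : E) (Ppi : P pi) (pi0 : pi != 0).

(** Membership in the ideal generated by [pi] in the localization at [P]. *)
Let loc x := exists2 u, O u /\ ~ P u & exists2 z, O z & u * x = pi * z.

(** An element of the socle of the localized quotient by [pi]. Otherwise [1] could be
    multiplied by elements of [P] indefinitely without entering the localized ideal
    [(pi)]; two of these products agree modulo [pi], and they differ by a factor [t]
    in [P], so that the local unit [1 - t] brings the first one into [(pi)]. *)
Let socle : exists b, [/\ O b, ~ loc b & forall y, P y -> loc (b * y)].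
Proof.
have Opi := prime_ideal_sub hP Ppi.
apply: contrapT => /forallNP noB.
have step b : O b /\ ~ loc b -> exists y, P y /\ ~ loc (b * y).
  move=> [Ob Zb]; apply: contrapT => /forallNP hb; apply: (noB b); split=> // y Py.
  by apply: contrapT => Zby; apply: (hb y).
have [g hg] : {g : E -> E & forall b, O b /\ ~ loc b -> P (g b) /\ ~ loc (b * g b)}.
  apply: (@choice _ _ (fun b y => O b /\ ~ loc b -> P y /\ ~ loc (b * y))) => b.
  have [/step[y hy]|] := pselect (O b /\ ~ loc b); first by exists y.
  by exists 0.
pose b n := iter n (fun x => x * g x) 1.
have bZ n : O (b n) /\ ~ loc (b n).
  elim: n => [|n IHn].
    split; first exact: integers1.
    move=> [u [Ou Pu] [z Oz]]; rewrite mulr1 => uE; apply: Pu; rewrite uE mulrC.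
    exact: (prime_idealM hP).
  have [Pg Zg] := hg _ IHn; split=> //=; apply: integersM; first by case: IHn.
  exact: (prime_ideal_sub hP).
have Pg n : P (g (b n)) by have [] := hg _ (bZ n).
have bdiv i k : exists2 y, P y & b (i + k.+1)%N = b i * y.
  elim: k => [|k [y Py IHk]]; first by exists (g (b i)); rewrite ?addn1.
  exists (y * g (b (i + k.+1)%N)); last by rewrite addnS /= IHk mulrA.
  by apply: (prime_idealM hP) => //; apply: (prime_ideal_sub hP).
have [c c0 [y Oy cE]] := integer_multiple Opi pi0.
have [i [j [ij [z Oz bij]]]] :=
  pigeonhole_mod hE Osubgroup c0 (fun i => proj1 (bZ i)).
have [t Pt bj] := bdiv i (j - i).-1.
rewrite prednK ?subn_gt0 // subnKC 1?ltnW // in bj.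
have [_] := bZ i; apply; exists (1 - t); first exact: (prime_1Bnotin hP).
exists (y * z); first exact: integersM.
by rewrite mulrA -cE -bij bj; ring.
Qed.

(** The prime [P] is finitely generated, so that finitely many local denominators
    have a common multiple. *)
Let common_denominator b : O b -> (forall y, P y -> loc (b * y)) ->
  exists2 v, O v /\ ~ P v & forall y, P y -> exists2 z, O z & v * (b * y) = pi * z.
Proof.
move=> Ob hb; have Opi := prime_ideal_sub hP Ppi.
have [c c0 [d Od cE]] := integer_multiple Opi pi0.
have [L LP hL] :=
  finite_mod_neq0 hE (ideal_subgroup (prime_ideal_ideal hP)) c0.
have [v [Ov Pv] hv] : exists2 v, O v /\ ~ P v &
    forall l, l \in L -> exists2 z, O z & v * (b * l) = pi * z.
  elim: L LP {hL} => [|l L IHL] LP.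
    exists 1 => //; split; first exact: integers1.
    exact: (prime_ideal1 hP).
  have [|v [Ov Pv] hv] := IHL; first by move=> m mL; apply: LP; rewrite inE mL orbT.
  have [|u [Ou Pu] [z Oz uE]] := hb l; first by apply: LP; rewrite inE eqxx.
  exists (u * v); first by split; [apply: integersM | apply: primeM_notin].
  move=> m; rewrite inE => /orP[/eqP->|/hv[t Ot tE]].
    exists (v * z); first exact: integersM.
    by rewrite mulrAC -mulrA [v * _]mulrC mulrA uE; ring.
  by exists (u * t); [exact: integersM | rewrite -mulrA tE; ring].
exists v => // y /hL[l /hv[z Oz zE] [t Pt ->]].
exists (z + v * b * d * t).
  apply: integersD => //; do !apply: integersM => //.
  exact: (prime_ideal_sub hP).
by rewrite cE mulrDr mulrDr zE; ring.
Qed.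

(** With [b] in the socle, [g = v b / pi] is not integral but maps [P] to integers.
    It cannot map [P] to itself, as it would be almost integral; so [g y] is a local
    unit for some [y] in [P], and then [P] is locally generated by [y]. *)
Lemma prime_locally_principal_of : exists y w, [/\ P y, O w, ~ P w
  & forall x, P x -> exists2 z, O z & w * x = y * z].
Proof.
have Opi := prime_ideal_sub hP Ppi.
have [b [Ob Zb hb]] := socle.
have [v [Ov Pv] hv] := common_denominator Ob hb.
pose g := v * b / pi.
have gP x : P x -> O (g * x).
  move=> /hv[z Oz zE]; suff -> : g * x = z by [].
  by apply: (mulfI pi0); rewrite -zE /g; field.
have [[y Py Pgy]|hg] := pselect (exists2 y, P y & ~ P (g * y)).
  exists y, (g * y); split=> //; first exact: gP.
  by move=> x Px; exists (g * x); [apply: gP | ring].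
case: Zb; exists v => //; exists g; last by rewrite /g; field.
have [c c0 Pc] := prime_ideal_int hP.
apply: (almost_integral c0) => k; apply: (prime_ideal_sub hP).
elim: k => [|k IHk]; first by rewrite mulr1.
rewrite exprS mulrCA; apply: contrapT => h.
by apply: hg; exists (c%:~R * g ^+ k).
Qed.

End LocallyPrincipal.

Lemma prime_locally_principal P : prime_ideal P -> exists y w, [/\ P y, O w, ~ P w
  & forall x, P x -> exists2 z, O z & w * x = y * z].
Proof.
move=> hP; have [pi Ppi pi0] := prime_ideal_neq0 hP.
exact: prime_locally_principal_of Ppi pi0.
Qed.

End Integers.

(** * Inertia is trivial when a uniformizer is fixed *)

Section Frobenius.
Variables (E : fieldType) (hE : number_field E) (P : set E) (hP : prime_ideal P).
Local Notation O := (@integers E).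
Local Notation Osubring := (@integers_subring E).

Lemma prime_ideal_prime : exists2 l, prime l & P l%:R.
Proof.
have [c c0 Pc] := prime_ideal_int hP.
have {Pc} : P `|c|%N%:R.
  case: c c0 Pc => [n|n] _ //; rewrite NegzE mulrNz => Pn.
  by rewrite -[_%:R]opprK; apply: (subgroupN (ideal_subgroup (prime_ideal_ideal hP))).
move: c0; rewrite -absz_gt0; move: `|c|%N => n {c}.
have [m] := ubnP n; elim: m n => // m IHm n lenm n_gt0 Pn.
have [n_le1|n_gt1] := leqP n 1.
  have n1 : n = 1%N by apply/eqP; rewrite eqn_leq n_le1.
  by case: (prime_ideal1 hP); rewrite n1 in Pn.
have l_pr := pdiv_prime n_gt1; have /dvdnP[k kE] := pdiv_dvd n.
move: Pn; rewrite {1}kE natrM => /(prime_idealP hP)[||Pk|]; last by exists (pdiv n).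
- exact: (integers_int E k).
- exact: (integers_int E (pdiv n)).
apply: (IHm k) => //; last by move: n_gt0; rewrite kE muln_gt0 => /andP[].
rewrite -ltnS (leq_trans _ lenm) // ltnS kE -[X in (X < _)%N]muln1.
by rewrite ltn_pmul2l ?prime_gt1 //; move: n_gt0; rewrite kE muln_gt0 => /andP[].
Qed.

(** All the binomial terms other than [a ^ l] and [b ^ l] are divisible by [l b]. *)
Lemma prime_exprD l a b : prime l -> O a -> O b ->
  exists2 z, O z & (a + b) ^+ l = a ^+ l + b ^+ l + l%:R * (b * z).
Proof.
case: l => // l l_pr Oa Ob.
exists (\sum_(i < l) a ^+ (l - i) * b ^+ i * ('C(l.+1, i.+1) %/ l.+1)%:R).
  apply: (subgroup_sum (subring_subgroup Osubring)) => i _.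
  by do 2?apply: integersM; try exact: integersX; exact: (integers_int E (_ %/ _)%N).
rewrite exprDn big_ord_recl big_ord_recr /= !subn0 bin0 expr0 mulr1 mulr1n.
rewrite subnn expr0 mul1r binn mulr1n -addrA; congr (_ + _); rewrite addrC.
congr (_ + _); rewrite !mulr_sumr; apply: eq_bigr => i _.
rewrite /bump /= add1n subSS.
have {1}-> : 'C(l.+1, i.+1) = ('C(l.+1, i.+1) %/ l.+1 * l.+1)%N.
  by rewrite divnK // prime_dvd_bin //= ltnS.
by rewrite -mulr_natr natrM exprS; ring.
Qed.

Variables (l : nat) (l_pr : prime l) (Pl : P l%:R).

Lemma primeMl z : O z -> P (l%:R * z).
Proof. by move=> Oz; rewrite mulrC; apply: (prime_idealM hP). Qed.

Lemma frobenius_inj k a b : O a -> O b -> P (a ^+ (l ^ k) - b ^+ (l ^ k)) -> P (a - b).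
Proof.
move=> Oa Ob; elim: k => [|k IHk] //.
rewrite expnSr !exprM => Pab; apply: IHk; move: Pab.
have := integersX (l ^ k) Oa; have := integersX (l ^ k) Ob.
move: (a ^+ _) (b ^+ _) => {Oa Ob}a {}b Ob Oa Pab.
have Oab := integersB Oa Ob.
apply: (@primeX _ _ hP _ l Oab).
have [z Oz] := prime_exprD l_pr Oab Ob; rewrite subrK => aE.
have -> : (a - b) ^+ l = (a ^+ l - b ^+ l) - l%:R * (b * z) by rewrite aE; ring.
by apply: (prime_idealB hP) => //; apply/primeMl/integersM.
Qed.

(** The Frobenius endomorphism of the residue field is injective with finite orbits. *)
Lemma frobenius_surj r : O r -> exists2 a, O a & P (r - a ^+ l).
Proof.
move=> Or; have l0 : l%:Z != 0 by rewrite -lt0n prime_gt0.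
have [i [j [ij [z Oz fij]]]] := pigeonhole_mod hE (subring_subgroup Osubring) l0
  (fun i => integersX (l ^ i) Or).
exists (r ^+ (l ^ (j - i).-1)); first exact: integersX.
rewrite -exprM -expnSr prednK ?subn_gt0 //.
apply: (@frobenius_inj i) => //; first exact: integersX.
by rewrite -exprM -expnD subnK 1?ltnW // fij; apply: primeMl.
Qed.

End Frobenius.

Section Inertia.
Variables (E : fieldType) (hE : number_field E) (P : set E) (hP : prime_ideal P).
Variables (pi : E) (Ppi : P pi).
Local Notation O := (@integers E).
Hypothesis uniformizer : forall x, P x ->
  exists2 u, O u /\ ~ P u & exists2 z, O z & u * x = pi * z.

(** The integers of valuation at least [n] at [P]. *)
Definition val_ge n x :=
  O x /\ exists2 u, O u /\ ~ P u & exists2 z, O z & u * x = pi ^+ n * z.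

Lemma val_ge1 x : P x -> val_ge 1 x.
Proof. by move=> Px; split; [exact: (prime_ideal_sub hP) | exact: uniformizer]. Qed.

Lemma val_geD n x y : val_ge n x -> val_ge n y -> val_ge n (x + y).
Proof.
move=> [Ox [u [Ou Pu] [z Oz zE]]] [Oy [v [Ov Pv] [t Ot tE]]]; split; first exact: integersD.
exists (u * v); first by split; [exact: integersM | exact: primeM_notin].
exists (v * z + u * t); first by apply: integersD; apply: integersM.
have -> : u * v * (x + y) = v * (u * x) + u * (v * y) by ring.
by rewrite zE tE; ring.
Qed.

Lemma val_geM m n x y : val_ge m x -> val_ge n y -> val_ge (m + n) (x * y).
Proof.
move=> [Ox [u [Ou Pu] [z Oz zE]]] [Oy [v [Ov Pv] [t Ot tE]]]; split; first exact: integersM.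
exists (u * v); first by split; [exact: integersM | exact: primeM_notin].
by exists (z * t); [exact: integersM | rewrite mulrACA zE tE exprD mulrACA].
Qed.

Lemma val_ge0 x : O x -> val_ge 0 x.
Proof.
move=> Ox; split=> //; exists 1; last by exists x; rewrite ?expr0.
by split; [exact: integers1 | exact: prime_ideal1].
Qed.

Lemma val_geMl n a x : O a -> val_ge n x -> val_ge n (a * x).
Proof. by move=> /val_ge0 Va /(val_geM Va). Qed.

Lemma val_geN n x : val_ge n x -> val_ge n (- x).
Proof. by rewrite -mulN1r; apply: val_geMl; apply/integersN/integers1. Qed.

Lemma val_ge_unit n u x : O u -> ~ P u -> O x -> val_ge n (u * x) -> val_ge n x.
Proof.
move=> Ou Pu Ox [_ [v [Ov Pv] [z Oz zE]]]; split=> //; exists (v * u).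
  by split; [exact: integersM | exact: primeM_notin].
by exists z; rewrite // -mulrA.
Qed.

(** If [pi^n] divides [x] locally for all [n], with quotients [z n], two of the [z n]
    are congruent modulo [x], and then [pi] is a local unit. *)
Lemma val_ge_separated x : (forall n, val_ge n x) -> x = 0.
Proof.
move=> Vx; apply/eqP/negPn/negP => x0; have [Ox _] := Vx 0%N.
have [c c0 [y Oy cE]] := integer_multiple Ox x0.
have hz n : exists z, O z /\ exists2 u, O u /\ ~ P u & u * x = pi ^+ n * z.
  by have [_ [u Pu [z Oz zE]]] := Vx n; exists z; split=> //; exists u.
have [z {}hz] := choice hz.
have [i [j [ij [t Ot tE]]]] := pigeonhole_mod hE
  (subring_subgroup (@integers_subring E)) c0 (fun n => proj1 (hz n)).
have [_ [u [Ou _] uE]] := hz i; have [_ [v [Ov Pv] vE]] := hz j.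
apply: Pv; have -> : v = pi ^+ (j - i).-1 * (u - pi ^+ i * y * t) * pi.
  apply: (mulIf x0); rewrite vE.
  have -> : z j = z i - c%:~R * t by rewrite -tE; ring.
  rewrite -{1}(subnKC (ltnW ij)) -(@prednK (j - i)) ?subn_gt0 // exprD exprS cE mulrBr.
  have -> : pi ^+ i * (pi * pi ^+ (j - i).-1) * z i = pi * pi ^+ (j - i).-1 * (u * x).
    by rewrite uE; ring.
  ring.
have Opi := prime_ideal_sub hP Ppi.
apply: (prime_idealM hP) => //; apply: integersM; first exact: integersX.
by apply: integersB => //; do !apply: integersM => //; apply: integersX.
Qed.

Variable s : {rmorphism E -> E}.
Hypothesis s_pi : s pi = pi.
Hypothesis inertia : forall r, O r -> P (s r - r).

(** Write [r] as a [l]-th power plus a multiple of [pi]: the power contributes one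
    more factor in [P] because its derivative vanishes modulo [P], the multiple of
    [pi] because [s] fixes [pi]. *)
Lemma inertia_trivial r : O r -> s r = r.
Proof.
move=> Or; apply/eqP; rewrite -subr_eq0; apply/eqP; apply: val_ge_separated => n.
have Osr x : O x -> O (s x - x) by move=> /inertia /(prime_ideal_sub hP).
elim: n r Or => [|[|n] IHn] r Or; first exact/val_ge0/Osr.
  exact/val_ge1/inertia.
have [l l_pr Pl] := prime_ideal_prime hP.
have [a Oa Pra] := frobenius_surj hE hP l_pr Pl Or.
have [u [Ou Pu] [t Ot tE]] := uniformizer Pra.
have stE : s u * (s r - s a ^+ l) = pi * s t.
  by rewrite -rmorphXn -rmorphB -rmorphM tE rmorphM s_pi.
have [Ox Ol] : P (s r - s a ^+ l) /\ val_ge n.+2 (s a ^+ l - a ^+ l).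
  split.
    have -> : s r - s a ^+ l = (r - a ^+ l) + (s (r - a ^+ l) - (r - a ^+ l)).
      by rewrite rmorphB rmorphXn; ring.
    by apply: primeD => //; apply: inertia; apply: prime_ideal_sub Pra.
  have [z Oz] := prime_exprD l_pr Oa (Osr _ Oa); rewrite addrC subrK => ->.
  have -> : a ^+ l + (s a - a) ^+ l + l%:R * ((s a - a) * z) - a ^+ l =
      (s a - a) * ((s a - a) ^+ l.-1 + l%:R * z).
    have -> : (s a - a) ^+ l = (s a - a) * (s a - a) ^+ l.-1.
      by rewrite -exprS prednK ?prime_gt0.
    ring.
  rewrite -addn1; apply: val_geM; first exact: IHn.
  apply/val_ge1/(primeD hP); last exact: primeMl.
  rewrite -(@prednK l.-1) -?subn1 ?subn_gt0 ?prime_gt1 // exprS mulrC.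
  by apply: (prime_idealM hP); [exact/integersX/Osr | exact: inertia].
apply: (@val_ge_unit _ u) => //; first exact: Osr.
have -> : u * (s r - r) = pi * (s t - t) + (- ((s u - u) * (s r - s a ^+ l)) +
    u * (s a ^+ l - a ^+ l)).
  by rewrite (mulrBr pi) -stE -tE; ring.
do !apply: val_geD; last exact: val_geMl.
  by rewrite -add1n; apply: val_geM; [exact: val_ge1 | exact: IHn].
by rewrite -addn1; apply/val_geN/val_geM; [exact: IHn | exact: val_ge1].
Qed.

End Inertia.

(** * Finite extensions of the rationals *)

Lemma fieldExt_number_field (L : fieldExtType rat) : number_field L.
Proof.
split=> [c c0|]; first exact: intr_base_neq0.
pose N := (\dim {:L}).+1; exists N => x.
have [k [i ki] kx] : exists2 k : 'I_N -> rat, exists i, k i != 0 & \sum_i k i *: x i = 0.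
  apply: contrapT => /forallPNP nok.
  suff : free [tuple x i | i < N].
    rewrite /free size_tuple => /eqP dimX.
    by have := dimvS (subvf <<[tuple x i | i < N]>>%VS); rewrite dimX ltnn.
  apply/freeP => k kx i; apply: contrapT => /eqP ki; apply: (nok k); first by exists i.
  by rewrite -[RHS]kx; apply: eq_bigr => j _; rewrite -tnth_nth tnth_mktuple.
pose c (j : 'I_N) := numq (k j) * \prod_(i | i != j) denq (k i).
pose d := \prod_i (denq (k i))%:~R : rat.
have cE j : (c j)%:~R = d * k j :> rat.
  rewrite intrM rmorph_prod /= numqE /d [in RHS](bigD1 j) //=.
  ring.
have d0 : d != 0 by apply/prodf_neq0 => j _; rewrite intr_eq0 denq_neq0.
exists (fun j => c (inord j)).
  exists i; rewrite ?ltn_ord // inord_val.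
  by rewrite -(intr_eq0 rat) cE mulf_neq0.
transitivity (d *: \sum_i k i *: x i); last by rewrite kx scaler0.
rewrite scaler_sumr; apply: eq_bigr => j _.
by rewrite inord_val mulrzl -scaler_int cE scalerA.
Qed.

Lemma number_field_ext (F : fieldExtType rat) (K : fieldExtType F) : number_field K.
Proof. exact: (fieldExt_number_field (baseFieldType K)). Qed.

Section Denominators.
Variables (E : fieldType) (hE : number_field E).

(** The product of [x] by the leading coefficient of an integral relation between its
    powers is a root of a monic polynomial. *)
Lemma integral_multiple (x : E) : exists2 c : int, c != 0 & integers (c%:~R * x).
Proof.
have [N /(_ (fun i => x ^+ i)) [c [i iN ci] cx]] := int_relation hE.
pose p := \poly_(i < N) c i.
have p0 : p != 0.
  by apply: contraNneq ci => p0; move: (coef_poly N c i); rewrite -/p iN p0 coef0 => <-.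
have intr0 (a : int) : (a%:~R == 0 :> E) = (a == 0).
  by apply/idP/eqP => [|->//]; apply: contraTeq; apply: (intr_neq0 hE).
have px : \sum_(i < size p) (p`_i)%:~R * x ^+ i = 0.
  rewrite -[RHS]cx (big_ord_widen N (fun i => (p`_i)%:~R * x ^+ i)) ?size_poly // big_mkcond /=.
  apply: eq_bigr => j _; case: ltnP => [_|]; first by rewrite coef_poly ltn_ord.
  by move/(nth_default 0) => pj; move: pj; rewrite coef_poly ltn_ord => ->; rewrite mul0r.
have := lead_coef_eq0 p; rewrite (negPf p0) lead_coefE.
case: (size p) (polySpred p0) px => // -[_|n _] /= px a0.
  by move: px => /eqP; rewrite big_ord1 expr0 mulr1 intr0 a0.
exists p`_n.+1; first by rewrite a0.
set a := p`_n.+1 in px a0 *.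
pose b i : E := (p`_i * a ^+ (n - i))%:~R.
apply: (@integral_root_monic _ _ _ _ ('X^(n.+1) + \poly_(i < n.+1) b i)).
- have sz : (size (\poly_(i < n.+1) b i) < size ('X^(n.+1) : {poly E}))%N.
    by rewrite size_polyXn ltnS size_poly.
  by rewrite monicE lead_coefDl ?lead_coefXn.
- rewrite rootE hornerD hornerXn horner_poly; apply/eqP.
  transitivity (a%:~R ^+ n * \sum_(i < n.+2) (p`_i)%:~R * x ^+ i); last by rewrite px mulr0.
  rewrite [in RHS]big_ord_recr /= mulrDr addrC.
  congr (_ + _); last by rewrite exprMn exprS; ring.
  rewrite mulr_sumr; apply: eq_bigr => j _; rewrite /b exprMn rmorphM rmorphXn /=.
  have jn : (j <= n)%N by rewrite -ltnS.
  have -> : a%:~R ^+ n = a%:~R ^+ (n - j) * a%:~R ^+ j :> E by rewrite -exprD subnK.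
  ring.
- apply/integral_poly => k; rewrite !coefE.
  apply: integral_add; first exact: integral_nat.
  by case: ltnP => _; [apply: integers_int | apply: integral0].
Qed.

End Denominators.

(** * The ring of T-integers *)

Section Tintegers.
Variables (E : fieldType) (hE : number_field E) (T : set (finite_prime E)).
Local Notation O := (@integers E).
Local Notation R := (Tintegers T).

Lemma Tintegers_subring : subring R.
Proof. by split; [exact: Tintegers1 | exact: TintegersB | exact: TintegersM]. Qed.

Lemma finite_prime_sub (P Q : finite_prime E) : pideal P `<=` pideal Q -> P = Q.
Proof.
move=> PQ; apply/finite_prime_eq/seteqP; split=> // x Qx; apply: contrapT => Px.
have Ox := prime_ideal_sub (pidealP Q) Qx.
have [y Oy /PQ] := prime_maximal hE (pidealP P) Ox Px.
move=> /(primeD (pidealP Q) (idealMr (prime_ideal_ideal (pidealP Q)) Qx Oy)).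
by rewrite addrC subrK; apply: prime_ideal1 (pidealP Q).
Qed.

(** The primes in [T] become the unit ideal: if [y] generates [P] locally, with [w]
    outside [P] such that [w P] is contained in [y O], then [w / y] is a T-integer. *)
Lemma Tintegers_prime M : ideal R M -> ~ M 1 ->
  (forall a b, R a -> R b -> M (a * b) -> M a \/ M b) ->
  (exists2 x, O x /\ M x & x != 0) ->
  exists2 P : finite_prime E, ~ T P & pideal P = M `&` O.
Proof.
move=> hM M1 primeM [x0 [Ox0 Mx0] x00].
have hP : prime_ideal (M `&` O).
  split.
  - by move=> x [].
  - by exists x0.
  - move=> x y [Mx Ox] [My Oy]; split; last exact: integersB.
    exact: (subgroupB (ideal_subgroup hM)).
  - move=> a x Oa [Mx Ox]; split; last exact: integersM.
    by apply: (idealM hM) => //; apply: integers_Tintegers.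
  - by case.
  - move=> a b Oa Ob [Mab _].
    by have [] := primeM _ _ (integers_Tintegers Oa) (integers_Tintegers Ob) Mab; [left|right].
exists (FinitePrime hP) => // TP.
have [y [w [[My Oy] Ow Pw hw]]] := prime_locally_principal hE hP.
apply: (Pw); split=> //.
have w0 : w != 0.
  by apply: contra_notN Pw => /eqP->; split; [exact: subgroup0 (ideal_subgroup hM)|exact: integers0].
have y0 : y != 0.
  apply: contraNneq x00 => y0; have [|z _] := hw x0; first by [].
  by rewrite y0 mul0r => /eqP; rewrite mulf_eq0 (negPf w0).
have -> : w = (w / y) * y by rewrite divfK.
apply: (idealM hM) => // Q TQ.
have [s Ps Qs] : exists2 s, (M `&` O) s & ~ pideal Q s.
  apply: contrapT => /forall2NP PQ; apply: TQ.
  rewrite -[Q](@finite_prime_sub (FinitePrime hP)) // => x Px.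
  by apply: contrapT => Qx; have [] := PQ x.
have [z Oz zE] := hw s Ps.
exists s; split=> //; first by case: Ps.
suff -> : s * (w / y) = z by [].
by rewrite mulrA [s * w]mulrC zE mulrAC divff ?mul1r.
Qed.

End Tintegers.

(** * Unramified extensions as Galois extensions of rings *)

Section Galois.
Variables (F : fieldExtType rat) (K : splittingFieldType F).
Hypothesis hKF : galois 1%AS {:K}%AS.
Local Notation G := (gal_of {:K}).
Local Notation OK := (@integers K).

Lemma gal_alg (s : G) (a : F) : s a%:A = a%:A.
Proof. by rewrite linearZ /= rmorph1. Qed.

Lemma gal_fixed (x : K) : (forall s : G, s x = x) -> exists a : F, x = a%:A.
Proof.
move=> sx; apply/vlineP; rewrite -[<[1]>%VS]/(1%AS : {vspace K}).
by rewrite -(galois_fixedField hKF); apply/fixedFieldP => [|s _]; rewrite ?memvf.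
Qed.

Lemma gal_mul (s t : G) x : (s * t)%g x = t (s x).
Proof. by rewrite galM ?memvf. Qed.

Lemma gal_eq1 (s : G) : (forall x, OK x -> s x = x) -> s = 1%g.
Proof.
move=> sO; apply/eqP/gal_eqP => x _; rewrite gal_id.
have [c c0 Ocx] := integral_multiple (number_field_ext K) x.
have c0K : c%:~R != 0 :> K := intr_ext_neq0 K c0.
by apply: (mulfI c0K); rewrite -(sO _ Ocx) rmorphM rmorph_int.
Qed.

Definition gal_trace (x : K) := \sum_(s : G) s x.

Lemma gal_trace_fixed x : exists a : F, gal_trace x = a%:A.
Proof.
apply: gal_fixed => t; rewrite rmorph_sum /= [RHS](reindex_inj (mulIg t)) /=.
by apply: eq_bigr => s _; rewrite gal_mul.
Qed.

Definition gal_norm (x : K) := \prod_(s : G) s x.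

Lemma gal_norm_fixed x : exists a : F, gal_norm x = a%:A.
Proof.
apply: gal_fixed => t; rewrite rmorph_prod /= [RHS](reindex_inj (mulIg t)) /=.
by apply: eq_bigr => s _; rewrite gal_mul.
Qed.

Lemma gal_norm_neq0 x : x != 0 -> gal_norm x != 0.
Proof. by move=> x0; apply/prodf_neq0 => s _; rewrite fmorph_eq0. Qed.

Lemma gal_norm_div (R : set K) x : subring R -> (forall (s : G) y, R y -> R (s y)) ->
  R x -> exists2 y, R y & gal_norm x = y * x.
Proof.
move=> hR sR Rx; exists (\prod_(s : G | s != 1%g) s x).
  by apply: subring_prod => // s _; apply: sR.
by rewrite /gal_norm (bigD1 1%g) //= gal_id mulrC.
Qed.

Variables (S : set (prime_of F)) (hunr : unramified_outside K S).
Local Notation T := (@S_ext F K S).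
Local Notation R := (Tintegers T).

(** As the ramification index is [1], the prime below contains an element [pi] that is
    not in [P ^ 2]. It is the product of a local generator of [P] by a local unit. *)
Lemma unramified_uniformizer (P : finite_prime K) : ~ T P ->
  exists2 pi : F, pideal P pi%:A
  & forall x, pideal P x ->
      exists2 u, OK u /\ ~ pideal P u & exists2 z, OK z & u * x = pi%:A * z.
Proof.
move=> TP; have hK := number_field_ext K; have hP := pidealP P.
have [_ ram] := hunr TP (erefl (prime_below P)).
set P2 := idexp _ _ _ in ram.
have P2D x y : P2 x -> P2 y -> P2 (x + y) by exact: idmulD.
have P2M a x : OK a -> P2 x -> P2 (a * x).
  move=> Oa; move: x; apply: idmul_ind => [|x y|x y Px Py].
  - by rewrite mulr0; apply: idmul0.
  - by rewrite mulrDr; apply: idmulD.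
  - by rewrite mulrA; apply: idmul_mem => //; apply: (prime_idealM hP).
have PP2 x y : pideal P x -> pideal P y -> P2 (x * y).
  move=> Px Py; apply: idmul_mem => //; rewrite -[y]mulr1.
  by apply: idmul_mem => //; apply: integers1.
have [pi Ppi P2pi] : exists2 pi : F, pideal P pi%:A & ~ P2 pi%:A.
  apply: contrapT => /forall2NP h; apply: ram.
  apply: idmul_ind => [||_ b [a Pa <-] Ob]; [exact: idmul0 | exact: P2D |].
  by rewrite mulrC; apply: P2M => //; have [|/contrapT] := h a.
have [y [w [Py Ow Pw hw]]] := prime_locally_principal hK hP.
exists pi => //.
have [z Oz zE] := hw _ Ppi.
have Pz : ~ pideal P z.
  move=> Pz; apply: P2pi; have [v Ov wv] := prime_maximal hK hP Ow Pw.
  have -> : pi%:A = pi%:A * (1 - w * v) + v * (w * pi%:A) :> K by ring.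
  by apply: P2D; [exact: PP2 | rewrite zE; apply: P2M => //; exact: PP2].
move=> x Px; have [t Ot tE] := hw _ Px.
exists (z * w); first by split; [exact: integersM | exact: (primeM_notin hP)].
exists (w * t); first exact: integersM.
by rewrite -mulrA tE mulrCA mulrA -zE; ring.
Qed.

Lemma unramified_inertia (P : finite_prime K) (s : G) : ~ T P -> s != 1%g ->
  exists2 r, OK r & ~ pideal P (s r - r).
Proof.
move=> TP; apply: contra_neqP => /forall2NP h; apply: gal_eq1.
have [pi Ppi unif] := unramified_uniformizer TP.
move=> x Ox.
apply: (inertia_trivial (number_field_ext K) (pidealP P) Ppi unif) => //.
  exact: gal_alg.
by move=> r Or; have [|/contrapT] := h r.
Qed.

(** A prime containing all the differences would have [s] in its inertia group. *)
Lemma unramified_differences (s : G) : s != 1%g ->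
  idmul [set y - s y | y in R] R 1.
Proof.
move=> s1; have hR := Tintegers_subring T; set D := idmul _ _.
have hD : ideal R D.
  by apply: ideal_idmul => // _ [y Ry <-]; apply: TintegersB => //; apply: Tintegers_gal.
have DB r : R r -> D (r - s r).
  by move=> Rr; rewrite -[_ - _]mulr1; apply: idmul_mem; [exists r | exact: Tintegers1].
apply: contrapT => D1; have [M [hM DM M1 maxM]] := maximal_ideal hR hD D1.
have [r Or sr] : exists2 r, OK r & s r <> r.
  apply: contrapT => /forall2NP h; move: s1; apply/negP/negPn/eqP/gal_eq1 => x Ox.
  by have [|/contrapT] := h x.
have Osr x : OK x -> OK (x - s x).
  by move=> Ox; apply: integersB => //; apply/(integers_rmorph s).
have [|P TP PM] := Tintegers_prime (number_field_ext K) hM M1 (maximal_ideal_prime hM maxM).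
  exists (r - s r); last by rewrite subr_eq0 eq_sym; apply/eqP.
  by split; [exact: Osr | exact/DM/DB/integers_Tintegers].
have [x Ox] := unramified_inertia TP s1; apply.
rewrite -opprB; apply: (subgroupN (ideal_subgroup (prime_ideal_ideal (pidealP P)))).
by rewrite PM; split; [exact/DM/DB/integers_Tintegers | exact: Osr].
Qed.

(** The functions on [G] given by the elements of the tensor square of [R]. *)
Definition tensor_fun (f : G -> K) := exists2 xs : seq (K * K),
  forall p, p \in xs -> R p.1 /\ R p.2 & forall t, f t = \sum_(p <- xs) p.1 * t p.2.

Lemma tensor_fun1 : tensor_fun (fun=> 1).
Proof.
exists [:: (1, 1)]; last by move=> t; rewrite big_seq1 /= rmorph1 mulr1.
by move=> p; rewrite inE => /eqP->; split; apply: Tintegers1.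
Qed.

Lemma tensor_funM f g : tensor_fun f -> tensor_fun g -> tensor_fun (fun t => f t * g t).
Proof.
move=> [xs hxs fE] [ys hys gE].
exists [seq (p.1 * q.1, p.2 * q.2) | p <- xs, q <- ys].
  move=> _ /allpairsP[[p q] /= [/hxs[Rp1 Rp2] /hys[Rq1 Rq2] ->]].
  by split; apply: TintegersM.
move=> t; rewrite fE gE big_allpairs_dep /= mulr_suml; apply: eq_bigr => p _.
rewrite mulr_sumr; apply: eq_bigr => q _.
by rewrite rmorphM mulrACA.
Qed.

(** If [1] is the sum of the [x_i (y_i - s(y_i))], take [f(t)] to be the sum of the
    [x_i t(y_i)] minus that of the [x_i s(y_i)]. *)
Lemma tensor_fun_sep (s : G) : s != 1%g ->
  exists2 f, tensor_fun f & f 1%g = 1 /\ f s = 0.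
Proof.
move=> /unramified_differences[xs hxs sumxs].
have [ys hys sumys] : exists2 ys : seq (K * K), forall p, p \in ys -> R p.1 /\ R p.2
    & 1 = \sum_(p <- ys) p.1 * (p.2 - s p.2).
  elim: xs {sumxs}1 hxs sumxs => [|p xs IHxs] x hxs; rewrite ?big_nil ?big_cons => ->.
    by exists [::]; rewrite ?big_nil.
  have [||ys hys ->] := IHxs (\sum_(p <- xs) p.1 * p.2) => //.
    by move=> q qxs; apply: hxs; rewrite inE qxs orbT.
  have [|[y Ry yE] Rp2] := hxs p; first by rewrite inE eqxx.
  exists ((p.2, y) :: ys); last by rewrite big_cons /= yE mulrC.
  by move=> q; rewrite inE => /orP[/eqP->|/hys].
pose c := \sum_(p <- ys) p.1 * s p.2.
exists (fun t => \sum_(p <- ys) p.1 * t p.2 - c).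
  exists ((- c, 1) :: ys).
    move=> q; rewrite inE => /orP[/eqP->|/hys//]; split; last exact: Tintegers1.
    apply: (subgroupN (subring_subgroup (Tintegers_subring T))).
    rewrite /c big_seq; apply: (subgroup_sum (subring_subgroup (Tintegers_subring T))).
    by move=> p /hys[Rp1 Rp2]; apply: TintegersM => //; apply: Tintegers_gal.
  by move=> t; rewrite big_cons /= rmorph1 mulr1 addrC.
split; last exact: subrr.
rewrite sumys -sumrB; apply: eq_bigr => p _.
by rewrite gal_id mulrBr.
Qed.

(** The separability idempotent of the Galois extension of rings. *)
Lemma tensor_fun_delta :
  exists2 f, tensor_fun f & f 1%g = 1 /\ forall s, s != 1%g -> f s = 0.
Proof.
suff H (A : seq G) : exists2 f, tensor_fun f & f 1%g = 1 /\
    forall s, s \in A -> s != 1%g -> f s = 0.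
  have [f hf [f1 f0]] := H (index_enum G); exists f => //; split=> // s.
  by apply: f0; rewrite mem_index_enum.
elim: A => [|s A [f hf [f1 f0]]]; first by exists (fun=> 1) => //; exact: tensor_fun1.
have [->|s1] := eqVneq s 1%g.
  exists f => //; split=> // t; rewrite inE => /orP[/eqP->|/f0//].
  by rewrite eqxx.
have [g hg [g1 gs]] := tensor_fun_sep s1.
exists (fun t => g t * f t); first exact: tensor_funM.
split=> [|t]; first by rewrite f1 g1 mulr1.
rewrite inE => /orP[/eqP-> _|/f0 ft /ft->]; last by rewrite mulr0.
by rewrite gs mul0r.
Qed.

(** Galois descent: [m] is the sum of the [x_i Tr(y_i m)] when the sum of the
    [x_i s(y_i)] is [1] or [0] according to whether [s] is [1]. *)
Lemma galois_descent (J : set K) : fractional T J -> (forall (s : G) x, J x -> J (s x)) ->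
  J `<=` idmul (in_alg K @` [set a | J a%:A]) R.
Proof.
move=> [J0 JD JM _] sJ m Jm; have [f [xs hxs fE] [f1 f0]] := tensor_fun_delta.
exists [seq (gal_trace (p.2 * m), p.1) | p <- xs].
  move=> _ /mapP[p /hxs[Rp1 Rp2] ->] /=; split=> //.
  have [a aE] := gal_trace_fixed (p.2 * m); exists a => //=; rewrite -aE.
  by rewrite /gal_trace; elim/big_ind: _ => // s _; apply/sJ/JM.
rewrite big_map /=.
transitivity (\sum_(s : G) f s * s m).
  by rewrite (bigD1 1%g) //= big1 ?addr0 ?f1 ?mul1r ?gal_id // => s /f0->; rewrite mul0r.
transitivity (\sum_(s : G) \sum_(p <- xs) p.1 * s p.2 * s m).
  by apply: eq_bigr => s _; rewrite fE mulr_suml.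
rewrite exchange_big; apply: eq_bigr => p _ /=; rewrite /gal_trace mulr_suml.
by apply: eq_bigr => s _; rewrite rmorphM; ring.
Qed.

End Galois.

(** * Descent of Galois-stable ideals *)

Section Descent.
Variables (F : fieldExtType rat) (K : splittingFieldType F).
Hypothesis hKF : galois 1%AS {:K}%AS.
Local Notation G := (gal_of {:K}).
Local Notation OF := (@integers F).
Local Notation OK := (@integers K).

Lemma idmul_alg_gal (I : set F) (B : set K) (s : G) x : (forall y, B y -> B (s y)) ->
  idmul (in_alg K @` I) B x -> idmul (in_alg K @` I) B (s x).
Proof.
move=> sB; move: x; apply: (idmul_ind (A := [set x | idmul _ B (s x)])) => /=.
- by rewrite rmorph0; apply: idmul0.
- by move=> x y hx hy; rewrite rmorphD; apply: idmulD.
- move=> _ b [a Ia <-] Bb; rewrite rmorphM /= gal_alg.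
  by apply: idmul_mem; [exists a | apply: sB].
Qed.

(** Take the norm of an expression [1 = \sum_i a i * b i] and collect the terms of its
    expansion by the monomial in the [a i] that they contain: the coefficient of a
    monomial is fixed by the Galois group. *)
Lemma ideal_extension1 (A I : set F) (B : set K) : subring A -> subring B ->
  (forall (s : G) x, B x -> B (s x)) -> (forall a : F, B a%:A -> A a) -> ideal A I ->
  idmul (in_alg K @` I) B 1 -> I 1.
Proof.
move=> hA hB sB BA hI [xs hxs sumxs]; have IG := ideal_subgroup hI.
pose n := size xs; pose x (i : 'I_n) := nth 0 xs i.
have [a ha] : {a : 'I_n -> F & forall i, I (a i) /\ (x i).1 = (a i)%:A}.
  apply: (@choice _ _ (fun i a => I a /\ (x i).1 = a%:A)) => i.
  by have [[a Ia aE] _] := hxs (x i) (mem_nth _ (ltn_ord i)); exists a; split.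
pose b i := (x i).2.
have Bb i : B (b i) by have [] := hxs (x i) (mem_nth _ (ltn_ord i)).
pose mult (f : {ffun G -> 'I_n}) : {ffun 'I_n -> 'I_(#|{: G}|.+1)} :=
  [ffun i => inord #|[pred s | f s == i]|].
pose monom (c : {ffun 'I_n -> 'I_(#|{: G}|.+1)}) := \prod_i a i ^+ c i.
pose coef c := \sum_(f | mult f == c) \prod_s (s : G) (b (f s)).
have monomE f : monom (mult f) = \prod_s a (f s).
  rewrite (partition_big f predT) //=; apply: eq_bigr => i _.
  rewrite (eq_bigr (fun=> a i)) => [|s /eqP-> //].
  by rewrite prodr_const ffunE inordK // ltnS max_card.
have coef_fixed c (t : G) : t (coef c) = coef c.
  rewrite rmorph_sum /=.
  rewrite [RHS](reindex_inj (h := fun f : {ffun G -> 'I_n} => [ffun s => f (s * t^-1)%g])) /=; last first.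
    move=> f g /ffunP fg; apply/ffunP => s; have := fg (s * t)%g.
    by rewrite !ffunE mulgK.
  apply: eq_big => f.
    congr (_ == _); apply/ffunP => i; rewrite !ffunE; congr inord.
    rewrite -[RHS](card_imset _ (mulIg t^-1)%g); apply: eq_card => s.
    rewrite inE; apply/idP/imsetP.
      by move=> fs; exists (s * t)%g; rewrite ?inE ?ffunE mulgK.
    by case=> u; rewrite inE ffunE => fu ->.
  move=> _; rewrite rmorph_prod /= [RHS](reindex_inj (mulIg t)) /=.
  by apply: eq_bigr => s _; rewrite ffunE mulgK gal_mul.
have [d hd] : {d & forall c, coef c = (d c)%:A}.
  apply: (@choice _ _ (fun c d => coef c = d%:A)) => c.
  exact: (gal_fixed hKF (coef_fixed c)).
have Ad c : A (d c).
  apply: BA; rewrite -hd; apply: (subgroup_sum (subring_subgroup hB)) => f _.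
  by apply: (subring_prod hB) => s _; apply: sB.
suff -> : 1 = \sum_c monom c * d c.
  apply: (subgroup_sum IG) => c _.
  have [/existsP[f /eqP <-]|/existsPn nof] := boolP [exists f, mult f == c].
    rewrite mulrC; apply: (idealM hI) => //; rewrite monomE (bigD1 1%g) //=.
    rewrite mulrC; apply: (idealM hI); last by have [] := ha (f 1%g).
    by apply: (subring_prod hA) => s _; have [/(ideal_sub hI)] := ha (f s).
  suff -> : d c = 0 by rewrite mulr0; apply: subgroup0 IG.
  apply: (fmorph_inj (in_alg K)); rewrite rmorph0 /= -hd.
  by rewrite /coef big_pred0 // => f; apply/negbTE/nof.
apply: (fmorph_inj (in_alg K)); rewrite rmorph1 rmorph_sum /=.
have one_sum (s : G) : 1 = \sum_(i < n) (a i)%:A * s (b i).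
  rewrite -[LHS](rmorph1 s) [X in s X = _]sumxs (big_nth 0) big_mkord rmorph_sum.
  by apply: eq_bigr => i _; rewrite rmorphM /= -/(x i) -/(b i) (proj2 (ha i)) gal_alg.
transitivity (\prod_(s : G) \sum_(i < n) (a i)%:A * s (b i)).
  by symmetry; apply: big1 => s _; rewrite -one_sum.
rewrite bigA_distr_bigA /= (partition_big mult predT) //=.
apply: eq_bigr => c _; rewrite algM -hd mulr_sumr.
apply: eq_bigr => f /eqP <-; rewrite big_split monomE; congr (_ * _).
by rewrite -[RHS]/(in_alg K _) rmorph_prod.
Qed.

Section Sintegers.
Variable S : set (prime_of F).
Local Notation RF := (Tintegers (S_base S)).
Local Notation RK := (Tintegers (@S_ext F K S)).

(** The denominators of [x] in [K] and the prime [p] generate the unit ideal; the norm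
    of a denominator congruent to [1] modulo [p] is a denominator in [F] that is not
    in [p], because [p] does not become the unit ideal in [K]. *)
Lemma Tintegers_alg (x : F) : RK x%:A -> RF x.
Proof.
move=> Rx p Sp; have hp := pidealP p.
have hOK := integers_subring K; have OKG := subring_subgroup hOK.
set pK := idmul (in_alg K @` pideal p) OK.
have hpK : ideal OK pK.
  by apply: ideal_idmul => // _ [a /(prime_ideal_sub hp) Oa <-]; apply/(integers_rmorph (in_alg K)).
have pKG := ideal_subgroup hpK.
have pK_mem a : pideal p a -> pK a%:A.
  move=> pa; rewrite -[a%:A]mulr1.
  by apply: idmul_mem; [exists a | exact: integers1].
pose D := [set d | OK d /\ OK (d * x%:A)].
pose N := [set y | exists2 d, D d & pK (y - d)].
have pK_sub_N y : pK y -> N y.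
  move=> py; exists 0; last by rewrite subr0.
  by split; rewrite ?mul0r; apply: integers0.
have D_sub_N d : D d -> N d.
  by move=> Dd; exists d => //; rewrite subrr; apply: subgroup0.
have hN : ideal OK N.
  split.
  - move=> y [d [Od _] /(ideal_sub hpK) Oyd].
    by rewrite -[y](subrK d); apply: integersD.
  - split; first by apply/pK_sub_N/(subgroup0 pKG).
    move=> y z [d [Od Odx] pd] [e [Oe Oex] pe]; exists (d - e).
      by split; rewrite ?mulrBl; apply: integersB.
    have -> : y - z - (d - e) = (y - d) - (z - e) by ring.
    exact: subgroupB.
  - move=> c y Oc [d [Od Odx] pd]; exists (c * d).
      by split; rewrite -?mulrA; apply: integersM.
    by rewrite -mulrBr; apply: (idealM hpK).
have [[d [Od Odx] pd]|N1] := pselect (N 1); last first.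
  have [M [hM NM M1 maxM]] := maximal_ideal hOK hN N1.
  have hP : prime_ideal M.
    split=> //; [exact: (ideal_sub hM) | | exact: (subgroupB (ideal_subgroup hM))
      | exact: (idealM hM) | exact: (maximal_ideal_prime hM)].
    have [a pa a0] := prime_ideal_neq0 hp; exists a%:A; last by rewrite (fmorph_eq0 (in_alg K)).
    exact/NM/pK_sub_N/pK_mem.
  have pP : p = prime_below (FinitePrime hP).
    apply: (finite_prime_sub (fieldExt_number_field F)) => a pa.
    exact/NM/pK_sub_N/pK_mem.
  have [|s [Os Ps Osx]] := Rx (FinitePrime hP); first by rewrite /S_ext /= -pP.
  by case: Ps; apply/NM/D_sub_N.
have [n nE] := gal_norm_fixed hKF d.
have sO (s : G) y : OK y -> OK (s y) by move/(integers_rmorph s).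
have [e Oe eE] := gal_norm_div hOK sO Od.
exists n; split.
- apply/(integers_rmorph (in_alg K)); rewrite /= -nE eE; exact: integersM.
- move=> pn; apply: (prime_ideal1 hp).
  apply: (ideal_extension1 (integers_subring F) hOK sO _ (prime_ideal_ideal hp)).
    by move=> a /(integers_rmorph (in_alg K)).
  have pKn : pK (gal_norm d) by rewrite nE; apply: pK_mem.
  suff [_ h] : OK (gal_norm d) /\ pK (1 - gal_norm d).
    by rewrite -/pK -[1](subrK (gal_norm d)); apply: subgroupD.
  apply: (big_ind (fun y => OK y /\ pK (1 - y))).
  - by split; [exact: integers1 | rewrite subrr; apply: subgroup0].
  - move=> y z [Oy py] [Oz pz]; split; first exact: integersM.
    have -> : 1 - y * z = y * (1 - z) + (1 - y) by ring.
    by apply: subgroupD => //; apply: (idealM hpK).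
  - move=> s _; split; first exact: sO.
    rewrite -(rmorph1 s) -rmorphB; apply: idmul_alg_gal => // y; exact: sO.
- apply/(integers_rmorph (in_alg K)); rewrite /= algM -nE eE -mulrA.
  exact: integersM.
Qed.

Lemma fractional_ideal (E : fieldType) (T : set (finite_prime E)) I :
  fractional T I -> I `<=` Tintegers T -> ideal (Tintegers T) I.
Proof.
move=> [I0 ID IM _] IR; split=> //; split=> // x y Ix Iy; apply: ID => //.
rewrite -mulN1r; apply: IM => //.
apply: (subgroupN (subring_subgroup (Tintegers_subring T))); exact: Tintegers1.
Qed.

Lemma ideal_eq1 (E : fieldType) (R I : set E) : ideal R I -> I 1 -> I = R.
Proof.
move=> hI I1; apply/seteqP; split; first exact: (ideal_sub hI).
by move=> x Rx; rewrite -[x]mulr1; apply: (idealM hI).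
Qed.

Lemma fractional_contract J : fractional (@S_ext F K S) J ->
  fractional (S_base S) [set a : F | J a%:A].
Proof.
move=> [J0 JD JM [d [d0 Rd hd]]]; have hR := Tintegers_subring (@S_ext F K S).
have [n nE] := gal_norm_fixed hKF d.
have [e Re eE] := gal_norm_div hR (@Tintegers_gal F K S) Rd.
split=> [|a b Ja Jb|a b Ra Jb|] /=.
- by rewrite scale0r.
- by rewrite scalerDl; apply: JD.
- by rewrite algM; apply: JM => //; apply: Tintegers_in_alg.
exists n; split.
- by rewrite -(fmorph_eq0 (in_alg K)) /= -nE gal_norm_neq0.
- by apply: Tintegers_alg; rewrite -nE eE; apply: TintegersM.
- move=> a Ja; apply: Tintegers_alg; rewrite algM -nE eE -mulrA.
  by apply: TintegersM => //; apply: hd.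
Qed.

Hypothesis hunr : unramified_outside K S.

Lemma extend_contract J : fractional (@S_ext F K S) J ->
  (forall (s : G) x, J x -> J (s x)) -> extend S [set a : F | J a%:A] = J.
Proof.
move=> hJ sJ; apply/seteqP; split; last exact: (galois_descent hKF hunr).
apply: idmul_ind; [exact: fractional0 hJ | exact: (fractionalD hJ) |].
by move=> _ b [a Ja <-] Rb; rewrite mulrC; apply: (fractionalM hJ).
Qed.

(** The contraction of the inverse ideal is an inverse of the contraction: their
    product becomes the unit ideal in [K]. *)
Lemma invertible_descent (J : ideal_group (@S_ext F K S)) :
  (forall (s : G) x, val J x -> val J (s x)) ->
  exists I : ideal_group (S_base S), extend_ideal K I = J.
Proof.
move=> sJ; have /asboolP[hJ [J' hJ' JJ']] := valP J.
have J'P x : J' x <-> forall y, val J y -> RK (x * y).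
  split=> [J'x y Jy|hx]; first by rewrite -JJ' mulrC; apply: idmul_mem.
  have : idmul (val J) J' 1 by rewrite JJ'; apply: Tintegers1.
  case=> xs hxs sumxs; rewrite -[x]mulr1 sumxs mulr_sumr big_seq.
  elim/big_ind: _ => [||p /hxs[Jp J'p]]; [exact: fractional0 hJ' | exact: (fractionalD hJ') |].
  by rewrite mulrA; apply: (fractionalM hJ') => //; apply: hx.
have sJ' (s : G) x : J' x -> J' (s x).
  move=> /J'P hx; apply/J'P => y Jy.
  have -> : s x * y = s (x * s^-1%g y) by rewrite rmorphM /= -(gal_mul s^-1%g s) mulVg gal_id.
  by apply: Tintegers_gal; apply: hx; apply: sJ.
pose I := [set a : F | val J a%:A]; pose I' := [set a : F | J' a%:A].
have fI : fractional (S_base S) I by apply: fractional_contract.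
have fI' : fractional (S_base S) I' by apply: fractional_contract.
have II'R : idmul I I' `<=` RF.
  apply: idmul_ind => [||a b Ia I'b]; [exact: Tintegers0 | exact: TintegersD |].
  by apply: Tintegers_alg; rewrite algM -JJ'; apply: idmul_mem.
have hII' := fractional_ideal (fractional_mul fI fI') II'R.
have II' : idmul I I' = RF.
  apply: ideal_eq1 => //; apply: (ideal_extension1 (Tintegers_subring _)
    (Tintegers_subring (@S_ext F K S)) (@Tintegers_gal F K S) Tintegers_alg hII').
  rewrite -[idmul _ _]/(extend S (idmul I I')) extend_mul !extend_contract // JJ'.
  exact: Tintegers1.
have invI : I \in invertible_pred (S_base S) by apply/asboolP; split=> //; exists I'.
by exists (exist _ I invI); apply: val_inj; rewrite /= extend_contract.
Qed.

End Sintegers.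

End Descent.

(** * Triviality of the Ostrowski quotient *)

Lemma quotient_inter_eq0 (V : zmodType) (A B : zmodClosed V) :
  {subset A <= B} -> forall x : quotient_inter A B, x = 0.
Proof.
move=> AB x; rewrite -[x]reprK -(raddf0 (\pi_(quotient_inter A B))).
apply/eqP; rewrite -Quotient.idealrBE subr0; apply: AB; exact: valP.
Qed.

HB.instance Definition _ (E : fieldType) := SemiGroup.isComLaw.Build (set E) (@idmul E)
  (@idmulA E) (@idmulC E).

Section Ostrowski.
Variables (F : fieldExtType rat) (K : splittingFieldType F).
Local Notation G := (gal_of {:K}).
Local Notation OK := (@integers K).

Lemma gal_integers (s : G) x : OK x -> OK (s x).
Proof. by move/(integers_rmorph s). Qed.

Lemma galKV (s : G) x : s (s^-1%g x) = x.
Proof. by rewrite -(gal_mul s^-1%g s) mulVg gal_id. Qed.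

Lemma galVK (s : G) x : s^-1%g (s x) = x.
Proof. by rewrite -{2}(invgK s) galKV. Qed.

Lemma residue_basis_gal (s : G) (P Q : finite_prime K) f (e : 'I_f -> K) :
  pideal Q = s @^-1` pideal P -> residue_basis P e ->
  residue_basis Q (fun i => s^-1%g (e i)).
Proof.
move=> QP [Oe gen free].
have sE (a : 'I_f -> F) : s (\sum_i a i *: s^-1%g (e i)) = \sum_i a i *: e i.
  rewrite rmorph_sum; apply: eq_bigr => i _.
  by rewrite -mulr_algl rmorphM /= gal_alg galKV mulr_algl.
split=> [i|x Ox|a Oa].
- exact/gal_integers/Oe.
- have [a Oa Pa] := gen _ (gal_integers s Ox); exists a => //.
  by rewrite QP; move: Pa; rewrite -sE -rmorphB.
- by rewrite QP (prime_below_gal QP) => Pa; apply: free => //; rewrite -sE.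
Qed.

Lemma residue_degree_gal (s : G) (P Q : finite_prime K) :
  pideal Q = s @^-1` pideal P -> residue_degree Q = residue_degree P.
Proof.
move=> QP; rewrite /residue_degree; congr xget; apply/seteqP; split=> f [e he].
  exists (fun i => s^-1%g^-1%g (e i)); apply: residue_basis_gal he.
  by rewrite QP; apply/seteqP; split=> x /=; rewrite galKV.
by exists (fun i => s^-1%g (e i)); apply: residue_basis_gal he.
Qed.

Lemma prime_norm_gal (s : G) (P Q : finite_prime K) :
  pideal Q = s @^-1` pideal P -> prime_norm Q = prime_norm P.
Proof. by move=> QP; rewrite /prime_norm (prime_below_gal QP) (residue_degree_gal QP). Qed.

(** The Galois group permutes the primes of given norm, and the order of the factors
    does not matter in a product of ideals. *)
Lemma Ostrowski_ideal_gal p f (s : G) x :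
  @Ostrowski_ideal F K p f x -> Ostrowski_ideal p f (s x).
Proof.
rewrite /Ostrowski_ideal; set A := _ @` _.
have bigs (L : seq (set K)) y : (\big[@idmul K/OK]_(P <- L) P) y ->
    (\big[@idmul K/OK]_(P <- [seq s @` P | P <- L]) P) (s y).
  elim: L y => [|P L IHL] y; rewrite /= ?big_nil ?big_cons; first exact: gal_integers.
  move: y; apply: (idmul_ind (A := [set y | idmul _ _ (s y)])) => /=.
  - by rewrite rmorph0; apply: idmul0.
  - by move=> y z hy hz; rewrite rmorphD; apply: idmulD.
  - by move=> a b Pa Lb; rewrite rmorphM; apply: idmul_mem; [exists a | apply: IHL].
move=> /bigs; rewrite (perm_big (fset_set A)) //=.
have [finA|infA] := pselect (finite_set A); last first.
  (* [fset_set] of an infinite set is empty. *)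
  by rewrite /fset_set; case: pselect.
have inj_s : injective (fun P : set K => s @` P).
  move=> P Q PQ; apply/seteqP; split=> y.
    move=> Py; have : (s @` Q) (s y) by rewrite -PQ; exists y.
    by case=> z Qz /(congr1 (s^-1%g)); rewrite !galVK => <-.
  move=> Qy; have : (s @` P) (s y) by rewrite PQ; exists y.
  by case=> z Pz /(congr1 (s^-1%g)); rewrite !galVK => <-.
have uL : uniq [seq s @` P | P <- fset_set A] by rewrite map_inj_uniq ?fset_uniq.
have subL : {subset [seq s @` P | P <- fset_set A] <= fset_set A}.
  move=> _ /mapP[Q QA ->]; move: QA; rewrite !in_fset_set // !inE => -[P NP <-{Q}].
  have hQ := prime_ideal_comap (s^-1%g : G) (intr_ext_neq0 K) (pidealP P).
  exists (FinitePrime hQ).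
    by rewrite /= (@prime_norm_gal s^-1%g P).
  apply/seteqP; split=> [y /= Py|_ [y Py <-] /=]; last by rewrite galVK.
  by exists (s^-1%g y); rewrite ?galKV.
have [|_ eqL] := uniq_min_size uL subL; first by rewrite size_map.
by apply: uniq_perm => //; apply: fset_uniq.
Qed.

Hypothesis hKF : galois 1%AS {:K}%AS.
Variables (S : set (prime_of F)) (hunr : unramified_outside K S).

Lemma Ost_trivial (x : Ost K S) : x = 0.
Proof.
apply: quotient_inter_eq0 x => c /asboolP; apply; first exact: im_zmod_closed.
move=> _ [p [f [I [_ _ IE ->]]]].
have [s x|I0 <-] := invertible_descent hKF hunr (J := I).
  rewrite IE; move: x.
  apply: (idmul_ind (A := [set x | idmul _ _ (s x)])) => /= [|x y hx hy|a b Pa Rb].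
  - by rewrite rmorph0; apply: idmul0.
  - by rewrite rmorphD; apply: idmulD.
  - by rewrite rmorphM; apply: idmul_mem; [exact: Ostrowski_ideal_gal | exact: Tintegers_gal].
by apply/asboolP; exists (\pi_(Cl (S_base S)) I0); exact: capitulation_pi.
Qed.

End Ostrowski.

(** * Principal ideals and units *)

Section Principal.
Variables (E : fieldType) (hE : number_field E) (T : set (finite_prime E)).
Local Notation R := (Tintegers T).

Lemma principal_eqP a b : a != 0 -> b != 0 ->
  principal T a = principal T b <-> a / b \in Tunit_pred T.
Proof.
move=> a0 b0.
have sub x y : x != 0 -> y != 0 -> principal T x `<=` principal T y <-> R (x / y).
  move=> x0 y0; split=> [xy|Rxy _ [r Rr <-]].
    have [|r Rr <-] := xy x; first by exists 1; rewrite ?mulr1 //; apply: Tintegers1.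
    by rewrite mulrAC mulfV // mul1r.
  by exists (x / y * r); [exact: TintegersM | field].
split=> [ab|/asboolP[_ Rab]]; last by rewrite invf_div => Rba; apply/seteqP; split; apply/sub.
apply/asboolP; split; rewrite ?mulf_neq0 ?invr_eq0 ?invf_div //.
  by apply/sub; rewrite ?ab.
by apply/sub; rewrite ?ab.
Qed.

Lemma principal1 : principal T 1 = R.
Proof.
by apply/seteqP; split=> [_ [x Rx <-]|x Rx]; rewrite ?mul1r //; exists x; rewrite ?mul1r.
Qed.

Lemma fractional_principal a : fractional T (principal T a).
Proof.
split.
- by exists 0; rewrite ?mulr0 //; apply: Tintegers0.
- by move=> _ _ [x Rx <-] [y Ry <-]; exists (x + y); rewrite ?mulrDr //; apply: TintegersD.
- by move=> c _ Rc [x Rx <-]; exists (c * x); [exact: TintegersM | rewrite mulrCA].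
have [c c0 Oca] := integral_multiple hE a; exists c%:~R; split.
- exact: (intr_neq0 hE).
- exact/integers_Tintegers/integers_int.
- by move=> _ [x Rx <-]; rewrite mulrA; apply: TintegersM => //; apply: integers_Tintegers.
Qed.

Lemma principalM a b : idmul (principal T a) (principal T b) = principal T (a * b).
Proof.
rewrite idmul_principal; last exact: fractional_principal.
apply/seteqP; split=> [_ [_ [r Rr <-] <-]|_ [r Rr <-]].
  by exists r => //; rewrite mulrCA mulrA.
by exists (a * r); [exists r | rewrite mulrCA mulrA].
Qed.

Lemma principal_invertible a : a != 0 -> principal T a \in invertible_pred T.
Proof.
move=> a0; apply/asboolP; split; first exact: fractional_principal.
exists (principal T a^-1); first exact: fractional_principal.
by rewrite principalM mulfV // principal1.
Qed.

Definition principal_ideal a (a0 : a != 0) : ideal_group T :=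
  exist _ (principal T a) (principal_invertible a0).

Lemma ideal_group_principalB (I J : ideal_group T) a b : a != 0 -> b != 0 ->
  val I = principal T a -> val J = principal T b -> val (I - J) = principal T (a / b).
Proof.
move=> a0 b0 Ia Jb.
have ab0 : a / b != 0 by rewrite mulf_neq0 ?invr_eq0.
suff -> : I - J = principal_ideal ab0 by [].
apply/eqP; rewrite subr_eq; apply/eqP/val_inj.
by rewrite Ia -[RHS]/(idmul (principal T (a / b)) (val J)) Jb principalM divfK.
Qed.

Lemma Cl_pi_eq0 (I : ideal_group T) :
  \pi_(Cl T) I = 0 <-> exists2 a, a != 0 & val I = principal T a.
Proof.
rewrite -(raddf0 (\pi_(Cl T))); split=> [/eqP|hI].
  by rewrite -Quotient.idealrBE subr0 => /asboolP.
by apply/eqP; rewrite -Quotient.idealrBE subr0; apply/asboolP.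
Qed.

End Principal.

(** * The capitulation kernel *)

Section Kernel.
Variables (F : fieldExtType rat) (K : splittingFieldType F).
Hypothesis hKF : galois 1%AS {:K}%AS.
Variables (S : set (prime_of F)) (hunr : unramified_outside K S).
Local Notation G := (gal_of {:K}).
Local Notation T := (@S_ext F K S).
Local Notation R := (Tintegers T).
Local Notation hK := (number_field_ext K).
Local Notation hF := (fieldExt_number_field F).
Local Notation ClF := (Cl (S_base S)).

(** By independence of automorphisms, the sum of the [f(s)^-1 s(x)] is nonzero for some
    [x]. *)
Lemma hilbert90 (f : G -> K) : (forall s, f s != 0) ->
  (forall s t, f (s * t)%g = f t * t (f s)) ->
  exists2 a : K, a != 0 & forall s : G, s a = f s * a.
Proof.
move=> f0 fM; have f1 : (f 1%g)^-1 != 0 by rewrite invr_eq0.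
have [x _] := @gal_independent_contra _ _ _ predT (fun s => (f s)^-1) 1%g isT f1.
set a := \sum_(s | _) _ => a0; exists a => // t.
rewrite rmorph_sum /= [in RHS]/a [in RHS](reindex_inj (mulIg t)) mulr_sumr /=.
apply: eq_bigr => s _; rewrite rmorphM fmorphV gal_mul fM mulrA; congr (_ * _).
by rewrite invfM mulrA mulfV ?mul1r.
Qed.

(** If [x] is in [I] and [I R = J R], then [x J^-1] consists of elements of [F] that are
    S-integers of [K], so [x] is in [J]. *)
Lemma extend_inj : injective (@extend_ideal F K S).
Proof.
have sub (I J : ideal_group (S_base S)) :
    extend_ideal K I = extend_ideal K J -> val I `<=` val J.
  move=> /(congr1 val)/= IJ x Ix.
  have /asboolP[hJ [J' hJ' JJ']] := valP J.
  have xJ' y : J' y -> Tintegers (S_base S) (x * y).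
    move=> J'y; apply: (Tintegers_alg hKF); rewrite algM -(extend1 K) -JJ' extend_mul -IJ.
    by apply: idmul_mem; apply: extend_mem.
  have : idmul (val J) J' 1 by rewrite JJ'; apply: Tintegers1.
  case=> xs hxs sumxs; rewrite -[x]mulr1 sumxs mulr_sumr big_seq.
  elim/big_ind: _ => [||p /hxs[Jp J'p]]; [exact: fractional0 hJ | exact: (fractionalD hJ) |].
  by rewrite mulrCA mulrC; apply: (fractionalM hJ) => //; apply: xJ'.
by move=> I J IJ; apply/val_inj/seteqP; split; apply: sub.
Qed.

(** The correspondence between capitulating classes and cocycles goes through this
    relation: [a] yields the cocycle [s(a) / a]. *)
Definition extension_generator (c : ClF) (a : K) :=
  exists I : ideal_group (S_base S),
    [/\ c = \pi_ClF I, a != 0 & val (extend_ideal K I) = principal T a].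

Lemma extension_generatorP (c : ClF) :
  capitulation K S c = 0 <-> exists a, extension_generator c a.
Proof.
split=> [|[a [I [-> a0 IE]]]]; last first.
  by rewrite [LHS]capitulation_pi; apply/Cl_pi_eq0; exists a.
rewrite -[c]reprK [X in X = _]capitulation_pi => /Cl_pi_eq0[a a0 IE].
by exists a, (generic_quotient.repr c); rewrite reprK.
Qed.

Lemma extension_generatorB c d a b :
  extension_generator c a -> extension_generator d b -> extension_generator (c - d) (a / b).
Proof.
move=> [I [-> a0 IE]] [J [-> b0 JE]]; exists (I - J); split.
- by rewrite raddfB.
- by rewrite mulf_neq0 ?invr_eq0.
rewrite -(ideal_group_principalB hK a0 b0 IE JE); congr val.
by apply/eqP; rewrite eq_sym subr_eq -extend_idealD subrK.
Qed.

(** The default value [0] of the group of units is the element [1] of [K]. *)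
Definition unit_of (x : K) : Sunits K S := insubd (0 : Tunits T) x.

Lemma val_unit_of x : x \in Tunit_pred T -> val (unit_of x) = x.
Proof. by move=> ux; rewrite val_insubd ux. Qed.

Definition gal_quotient (a : K) : {ffun G -> Sunits K S} := [ffun s : G => unit_of (s a / a)].

Lemma gal_quotient_unit c a (s : G) : extension_generator c a -> s a / a \in Tunit_pred T.
Proof.
move=> [I [_ a0 IE]]; have sa0 (t : G) : t a != 0 by rewrite fmorph_eq0.
apply/principal_eqP => //.
have gal_principal (t : G) x : principal T a x -> principal T a (t x).
  by rewrite -IE; apply: extend_gal.
apply/seteqP; split=> [_ [r Rr <-]|x ax].
  rewrite -[r](galKV s) -rmorphM; apply: gal_principal.
  by exists (s^-1%g r) => //; apply: Tintegers_gal.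
rewrite -[x](galKV s); have [r Rr <-] := gal_principal s^-1%g _ ax.
by exists (s r); [exact: Tintegers_gal | rewrite rmorphM].
Qed.

Lemma gal_quotientE c a (s : G) : extension_generator c a -> val (gal_quotient a s) = s a / a.
Proof. by move=> ca; rewrite ffunE val_unit_of //; apply: gal_quotient_unit ca. Qed.

Lemma gal_quotient_cocycle c a : extension_generator c a ->
  gal_quotient a \in cocycle (@gal_Sunits F K S).
Proof.
move=> ca; apply/'forall_forallP => s t; apply/eqP/val_inj.
rewrite -[RHS]/(val (gal_quotient a t) * t (val (gal_quotient a s))) !(gal_quotientE _ ca).
have [I [_ a0 _]] := ca; have ta0 : t a != 0 by rewrite fmorph_eq0.
by rewrite rmorphM fmorphV gal_mul; field; rewrite ta0 a0.
Qed.

Lemma gal_quotientB c d a b : extension_generator c a -> extension_generator d b ->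
  gal_quotient (a / b) = gal_quotient a - gal_quotient b.
Proof.
move=> ca db; apply/ffunP => s; apply: val_inj.
rewrite (gal_quotientE _ (extension_generatorB ca db)) ffunE [X in _ + X]ffunE.
rewrite -[RHS]/(val (gal_quotient a s) / val (gal_quotient b s)).
rewrite (gal_quotientE _ ca) (gal_quotientE _ db).
have [_ [_ a0 _]] := ca; have [_ [_ b0 _]] := db.
have sb0 : s b != 0 by rewrite fmorph_eq0.
by rewrite rmorphM fmorphV; field; rewrite a0 b0 sb0.
Qed.

(** If [s(a) / a = s(u) / u] for a unit [u], then [a / u] is in [F] and generates the
    ideal. Conversely, if the ideal is generated by [x] in [F], the generators [a] and
    [x] of its extension differ by a unit. *)
Lemma gal_quotient_coboundary c a : extension_generator c a ->
  gal_quotient a \in coboundary (@gal_Sunits F K S) <-> c = 0.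
Proof.
move=> ca; have [I [cI a0 IE]] := ca; split=> [/asboolP[u uE]|c0].
  have /asboolP[u0 Ru Ru'] := valP u.
  have [x xE] : exists x : F, a / val u = x%:A.
    apply: (gal_fixed hKF) => s; have := congr1 val (uE s).
    rewrite (gal_quotientE _ ca) -[RHS]/(s (val u) / val u) => sE.
    have su0 : s (val u) != 0 by rewrite fmorph_eq0.
    have -> : s (a / val u) = (s a / a) * a / s (val u) by rewrite divfK // rmorphM fmorphV.
    by rewrite sE; field; rewrite u0 su0.
  have x0 : x != 0.
    by rewrite -(fmorph_eq0 (in_alg K)) /= -xE mulf_neq0 ?invr_eq0.
  rewrite cI; apply/Cl_pi_eq0; exists x => //.
  suff -> : I = principal_ideal hF (S_base S) x0 by [].
  apply/extend_inj/val_inj; rewrite IE /= extend_principal -xE.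
  have au0 : a / val u != 0 by rewrite mulf_neq0 ?invr_eq0.
  by apply/principal_eqP => //; rewrite invf_div mulrCA mulfV // mulr1; exact: valP.
have [x x0 Ix] : exists2 x, x != 0 & val I = principal (S_base S) x.
  by apply/Cl_pi_eq0; rewrite -cI.
have xK0 : x%:A != 0 :> K by rewrite (fmorph_eq0 (in_alg K)).
have uP : a / x%:A \in Tunit_pred T.
  by apply/principal_eqP => //; rewrite -IE /= Ix extend_principal.
apply/asboolP; exists (unit_of (a / x%:A)) => s; apply: val_inj.
rewrite (gal_quotientE _ ca) -[RHS]/(s (val (unit_of _)) / val (unit_of _)) val_unit_of //.
have -> : s (a / x%:A) = s a / x%:A by rewrite rmorphM fmorphV /= gal_alg.
by field; rewrite a0 xK0.
Qed.

Lemma cocycle_gal_quotient f : f \in cocycle (@gal_Sunits F K S) ->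
  exists c a, extension_generator c a /\ f = gal_quotient a.
Proof.
move=> /'forall_forallP fcoc.
have f0 s : val (f s) != 0 by have /asboolP[] := valP (f s).
have [|a a0 fa] := hilbert90 f0; first by move=> s t; rewrite (eqP (fcoc s t)).
have sa0 (s : G) : s a != 0 by rewrite fmorph_eq0.
have fE (s : G) : s a / a = val (f s) by rewrite fa mulfK.
have [s x [r Rr <-]|I IE] := invertible_descent hKF hunr (J := principal_ideal hK T a0).
  have fsr : s (a * r) = a * (val (f s) * s r) by rewrite rmorphM /= fa [val (f s) * a]mulrC -mulrA.
  exists (val (f s) * s r) => //.
  by apply: TintegersM; [have /asboolP[] := valP (f s) | exact: Tintegers_gal].
have ca : extension_generator (\pi_ClF I) a by exists I; split=> //; rewrite IE.
exists (\pi_ClF I), a; split=> //.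
by apply/ffunP => s; apply: val_inj; rewrite (gal_quotientE _ ca) fE.
Qed.

Local Notation Z1 := (cocycle (@gal_Sunits F K S)).
Local Notation B1 := (coboundary (@gal_Sunits F K S)).

(** Defined on all functions, with the trivial class as default value, so that
    membership proofs stay out of the terms. *)
Definition H1_class (f : {ffun G -> Sunits K S}) : H1_Sunits K S :=
  \pi_(H1_Sunits K S) (insubd (0 : subgroup_of Z1) f).

Lemma val_cocycle f : f \in Z1 -> val (insubd (0 : subgroup_of Z1) f) = f.
Proof. by move=> Zf; rewrite val_insubd Zf. Qed.

Lemma H1_class_eq f g : f \in Z1 -> g \in Z1 -> H1_class f = H1_class g <-> f - g \in B1.
Proof.
move=> Zf Zg; rewrite -[X in X - _](val_cocycle Zf) -[X in _ - X](val_cocycle Zg) -raddfB.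
split=> [/eqP|fg]; first by rewrite -Quotient.idealrBE; apply.
by apply/eqP; rewrite -Quotient.idealrBE; apply: fg.
Qed.

Lemma H1_classB f g : f \in Z1 -> g \in Z1 -> H1_class (f - g) = H1_class f - H1_class g.
Proof.
move=> Zf Zg; rewrite -raddfB; congr (\pi _); apply: val_inj.
by rewrite val_cocycle ?rpredB // [RHS]raddfB /= !val_cocycle.
Qed.

Lemma Ker_generator (x : Ker (capitulation K S)) : {a | extension_generator (val x) a}.
Proof.
apply: cid; apply/extension_generatorP.
by apply/eqP; have := valP x.
Qed.

Definition Ker_to_H1 (x : Ker (capitulation K S)) : H1_Sunits K S :=
  H1_class (gal_quotient (sval (Ker_generator x))).

Lemma Ker_to_H1E (x : Ker (capitulation K S)) a : extension_generator (val x) a ->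
  Ker_to_H1 x = H1_class (gal_quotient a).
Proof.
move=> xa; rewrite /Ker_to_H1; case: Ker_generator => b xb /=.
apply/H1_class_eq; [exact: gal_quotient_cocycle xb | exact: gal_quotient_cocycle xa |].
rewrite -(gal_quotientB xb xa).
by apply/(gal_quotient_coboundary (extension_generatorB xb xa)); rewrite subrr.
Qed.

Lemma Ker_to_H1_zmod_morphism : zmod_morphism Ker_to_H1.
Proof.
move=> x y; have [a xa] := Ker_generator x; have [b yb] := Ker_generator y.
rewrite (Ker_to_H1E xa) (Ker_to_H1E yb) -H1_classB; last first.
- exact: gal_quotient_cocycle yb.
- exact: gal_quotient_cocycle xa.
rewrite -(gal_quotientB xa yb); apply: Ker_to_H1E.
by rewrite raddfB; apply: extension_generatorB.
Qed.
HB.instance Definition _ := GRing.isZmodMorphism.Build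
  (Ker (capitulation K S)) (H1_Sunits K S) Ker_to_H1 Ker_to_H1_zmod_morphism.

Lemma H1_class0 : H1_class 0 = 0.
Proof.
by rewrite -(subrr (0 : {ffun G -> Sunits K S})) H1_classB ?rpred0 // subrr.
Qed.

Lemma Ker_to_H1_inj : injective Ker_to_H1.
Proof.
apply: raddf_inj => x; have [a xa] := Ker_generator x.
rewrite [X in X = _](Ker_to_H1E xa) -H1_class0.
move=> /(H1_class_eq (gal_quotient_cocycle xa) (rpred0 _)); rewrite subr0 => /(gal_quotient_coboundary xa) x0.
by apply: val_inj; rewrite x0 raddf0.
Qed.

Lemma Ker_to_H1_surj h : exists x, Ker_to_H1 x = h.
Proof.
have [c [a [ca fE]]] := cocycle_gal_quotient (valP (generic_quotient.repr h)).
have kerc : c \in ker_pred (capitulation K S).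
  by apply/eqP/extension_generatorP; exists a.
exists (exist _ c kerc); rewrite (@Ker_to_H1E _ a) // -fE -[RHS]reprK.
by congr (\pi _); apply: val_inj; rewrite val_cocycle //; apply: valP.
Qed.

Lemma Ker_to_H1_bij : bijective Ker_to_H1.
Proof.
have [g gK] := choice Ker_to_H1_surj.
by exists g => // x; apply: Ker_to_H1_inj; rewrite gK.
Qed.

Lemma Ker_isomorphic_H1 :
  exists phi : {additive Ker (capitulation K S) -> H1_Sunits K S}, bijective phi.
Proof. by exists Ker_to_H1; apply: Ker_to_H1_bij. Qed.

End Kernel.

Theorem theorem2p13 (F : fieldExtType rat) (K : splittingFieldType F)
    (hKF : galois 1%AS {:K}%AS)
    (S : set (prime_of F)) (hSfin : finite_set S)
    (hSinf : forall v : arch_prime F, S (Arch v))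
    (hunr : unramified_outside K S) :
  (exists phi : {additive Ker (capitulation K S) -> H1_Sunits K S}, bijective phi) /\
  (forall x : Ost K S, x = 0).
Proof.
split; first exact: Ker_isomorphic_H1.
exact: Ost_trivial.
Qed.
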